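(* Let $n$ be a positive integer, $p \geq n$ a real number, and $E, F$ Banach spaces. A polynomial $P \in \mathcal{P}(^nE;F)$ is $p$-dominated if and only if there are a regular Borel probability measure $\mu$ on $B_{E'}$ (with the weak* topology) and a continuous linear operator $v \colon \widehat{\otimes}^{n,s}_{\pi_s} G_{E,p}^\mu \longrightarrow F$ such that $$P = v \circ \delta_n^{G_{E,p}^\mu} \circ j_p^e \circ e .$$ Moreover, $\|v\| = \|P\|_{d,p}$.
   Context: $\mathcal{P}(^nE;F)$ is the space of continuous $n$-homogeneous polynomials from $E$ to $F$. $B_{E'}$ is the closed unit ball of the dual $E'$ with the weak* topology. $P \in \mathcal{P}(^nE;F)$ is $p$-dominated if it sends weakly $p$-summable sequences in $E$ to absolutely $\frac{p}{n}$-summable sequences in $F$; it is known that this holds if and only if there are $C>0$ and a regular Borel probability measure $\mu$ on $B_{E'}$ with $\|P(x)\| \leq C \left(\int_{B_{E'}} |\varphi(x)|^p \, d\mu(\varphi)\right)^{n/p}$ for every $x \in E$. $\|P\|_{d,p}$ denotes the infimum of all constants $C$ satisfying such an inequality (over all $\mu$). $e \colon E \to C(B_{E'})$, $e(x)(\varphi)=\varphi(x)$, is a linear isometry; $j_p \colon C(B_{E'})\to L_p(\mu)$ is the canonical map; $j_p^e$ is its restriction to $e(E)$. $G_{E,p}^\mu$ is the closure of $j_p^e\circ e(E)$ in $L_p(\mu)$. For a Banach space $X$, $\widehat{\otimes}^{n,s}_{\pi_s}X$ is the completion of the $n$-fold symmetric tensor product $\otimes^{n,s}X$ with respect to the projective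 $s$-tensor norm $\pi_s(\theta)=\inf\{\sum_{i=1}^m|\lambda_i|\|x_i\|^n : \theta=\sum_{i=1}^m\lambda_i\otimes^n x_i\}$, where $\otimes^n x := x\otimes\cdots\otimes x$, and $\delta_n^X \colon X \to \widehat{\otimes}^{n,s}_{\pi_s}X$ is the map $\delta_n^X(x) = \otimes^n x$. *)

(* Defs.v *)
From HB Require Import structures.
From mathcomp Require Import all_boot all_order all_algebra.
From mathcomp Require Import complex.
From mathcomp Require Import all_classical all_reals all_analysis.
From mathcomp Require Import measurable_realfun.

Set Implicit Arguments.
Unset Strict Implicit.
Unset Printing Implicit Defensive.
Import Order.TTheory GRing.Theory Num.Theory.
Import numFieldNormedType.Exports.
Local Open Scope classical_set_scope.
Local Open Scope ring_scope.

(* Banach spaces are real or complex. *)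
Variant scalar_field := RealScalars | ComplexScalars.

Definition scalars (R : realType) (k : scalar_field) : numFieldType :=
  match k with RealScalars => R | ComplexScalars => R[i] end.

Section Scalars.
Context {R : realType} {k : scalar_field}.
Local Notation K := (scalars R k).

Definition sRe : K -> R :=
  match k return scalars R k -> R with
  | RealScalars => id
  | ComplexScalars => @complex.Re R
  end.

Definition sIm : K -> R :=
  match k return scalars R k -> R with
  | RealScalars => fun=> 0
  | ComplexScalars => @complex.Im R
  end.

Definition of_real : R -> K :=
  match k return R -> scalars R k with
  | RealScalars => id
  | ComplexScalars => fun r => Complex r 0
  end.

(* MathComp norms on a K-module are K-valued; [rnorm x] is `|x| as a real. *)
Definition rnorm {X : normedZmodType K} (x : X) : R := sRe `|x|.

Lemma of_realK r : sRe (of_real r) = r.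
Proof. by rewrite /sRe /of_real; case: (k). Qed.

Lemma of_realD r s : of_real (r + s) = of_real r + of_real s.
Proof. by rewrite /of_real; case: k => //=; simpc. Qed.

Lemma of_realM r s : of_real (r * s) = of_real r * of_real s.
Proof. by rewrite /of_real; case: k => //=; simpc. Qed.

Lemma of_real_le r s : (of_real r <= of_real s) = (r <= s).
Proof. by rewrite /of_real; case: k => //=; simpc. Qed.

Lemma of_real_lt r s : (of_real r < of_real s) = (r < s).
Proof. by rewrite /of_real; case: k => //=; simpc. Qed.

Lemma of_real_inj : injective of_real.
Proof. exact: can_inj of_realK. Qed.

Lemma of_real0 : of_real 0 = 0.
Proof. by rewrite /of_real; case: k. Qed.

Lemma of_real_gt0 r : (0 < of_real r) = (0 < r).
Proof. by rewrite -of_real0 of_real_lt. Qed.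

Lemma of_real1 : of_real 1 = 1.
Proof. by rewrite /of_real; case: k. Qed.

Lemma of_real_sRe (z : K) : 0 <= z -> of_real (sRe z) = z.
Proof.
rewrite /of_real /sRe; case: k z => //= -[a b].
by rewrite lecE /= => /andP[/eqP -> _].
Qed.

Lemma rnormE (X : normedZmodType K) (x : X) : of_real (rnorm x) = `|x|.
Proof. by rewrite of_real_sRe. Qed.

Lemma rnorm_ge0 (X : normedZmodType K) (x : X) : 0 <= rnorm x.
Proof. by rewrite -of_real_le rnormE of_real0. Qed.

Lemma rnorm0 (X : normedZmodType K) : rnorm (0 : X) = 0.
Proof. by apply: of_real_inj; rewrite rnormE of_real0 normr0. Qed.

Lemma rnorm_eq0 (X : normedZmodType K) (x : X) : rnorm x = 0 -> x = 0.
Proof. by move=> x0; apply: normr0_eq0; rewrite -rnormE x0 of_real0. Qed.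

Lemma rnormD (X : normedZmodType K) (x y : X) :
  rnorm (x + y) <= rnorm x + rnorm y.
Proof. by rewrite -of_real_le of_realD !rnormE ler_normD. Qed.

Lemma rnormM (a b : K) : rnorm (a * b) = rnorm a * rnorm b.
Proof. by apply: of_real_inj; rewrite of_realM !rnormE normrM. Qed.

Lemma rnormZ (X : normedModType K) (a : K) (x : X) :
  rnorm (a *: x) = rnorm a * rnorm x.
Proof. by apply: of_real_inj; rewrite of_realM !rnormE normrZ. Qed.

Lemma rnormN (X : normedZmodType K) (x : X) : rnorm (- x) = rnorm x.
Proof. by rewrite /rnorm normrN. Qed.

Lemma rnorm1 : rnorm (1 : K) = 1.
Proof. by rewrite /rnorm normr1 /sRe; case: k. Qed.

Lemma rnormV (a : K) : rnorm a^-1 = (rnorm a)^-1.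
Proof.
have [->|a0] := eqVneq a 0; first by rewrite invr0 rnorm0 invr0.
have ra0 : rnorm a != 0 by apply: contra a0 => /eqP/rnorm_eq0 ->.
by apply: (mulfI ra0); rewrite -rnormM !mulfV// rnorm1.
Qed.

End Scalars.

(** Meaningful for continuous linear maps only: [sup] of an unbounded set is 0. *)
Definition opnorm {R : realType} {k : scalar_field}
    {X Y : normedModType (scalars R k)} (f : X -> Y) : R :=
  sup [set rnorm (f x) | x in [set x | rnorm x <= 1]].

Record seminorm (R : realType) (k : scalar_field)
    (V : lmodType (scalars R k)) := Seminorm {
  seminorm_fun :> V -> R ;
  seminormD : forall x y, seminorm_fun (x + y) <= seminorm_fun x + seminorm_fun y ;
  seminormZ : forall a x, seminorm_fun (a *: x) = rnorm a * seminorm_fun x }.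

Section SeminormTheory.
Context {R : realType} {k : scalar_field} {V : lmodType (scalars R k)}.
Local Notation K := (scalars R k).
Implicit Types q : seminorm V.

Lemma seminorm0 q : q 0 = 0.
Proof. by rewrite -[X in q X](scale0r 0) seminormZ rnorm0 mul0r. Qed.

Lemma seminormN q x : q (- x) = q x.
Proof. by rewrite -scaleN1r seminormZ rnormN rnorm1 mul1r. Qed.

Lemma seminorm_ge0 q x : 0 <= q x.
Proof.
have := seminormD q x (- x).
by rewrite subrr seminorm0 seminormN -mulr2n pmulrn_lge0.
Qed.

Lemma seminorm_dist q x y : `|q x - q y| <= q (x - y).
Proof.
have h u v : q u - q v <= q (u - v).
  by rewrite lerBlDr (le_trans _ (seminormD q _ _))// subrK.
by rewrite ler_norml h andbT lerNl opprB -(seminormN q (x - y)) opprB h.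
Qed.

Definition null_pred q : {pred V} := fun x => q x == 0.

Lemma null_pred_zmod_closed q : zmod_closed (null_pred q).
Proof.
split=> [|x y /eqP qx /eqP qy]; first exact/eqP/seminorm0.
apply/eqP/le_anti; rewrite seminorm_ge0 andbT.
by rewrite (le_trans (seminormD _ _ _))// seminormN qx qy addr0.
Qed.

HB.instance Definition _ q :=
  GRing.isZmodClosed.Build V (null_pred q) (null_pred_zmod_closed q).

(** [sepspace q] is the normed space V / {x | q x = 0}, and [seppi q] the
    canonical surjection onto it. *)
Definition sepspace q : Type := Quotient.quot (null_pred q).
HB.instance Definition _ q := GRing.Zmodule.on (sepspace q).

Definition seppi q (x : V) : sepspace q := (\pi_(Quotient.quot (null_pred q)) x)%qT.

Definition seprepr q (u : sepspace q) : V := repr (u : Quotient.quot (null_pred q)).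

Lemma sepreprK q : cancel (@seprepr q) (seppi q).
Proof. by move=> u; rewrite /seppi /seprepr reprK. Qed.

Lemma seppi_eq q x y : seppi q x = seppi q y <-> q (x - y) = 0.
Proof.
split=> [/eqP|/eqP xy]; last first.
  by apply/eqP; rewrite -[_ == _]Quotient.idealrBE.
by rewrite -[_ == _]Quotient.idealrBE => /eqP.
Qed.

Lemma seppiD q x y : seppi q (x + y) = seppi q x + seppi q y.
Proof. by rewrite /seppi raddfD. Qed.

Definition sepscale q a (u : sepspace q) : sepspace q :=
  seppi q (a *: seprepr u).

Lemma seppiZ q a x : sepscale a (seppi q x) = seppi q (a *: x).
Proof.
apply/seppi_eq; rewrite -scalerBr seminormZ.
by have /seppi_eq -> := sepreprK (seppi q x); rewrite mulr0.
Qed.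

Lemma sepscaleA q a b (u : sepspace q) :
  sepscale a (sepscale b u) = sepscale (a * b) u.
Proof. by rewrite -(sepreprK u) !seppiZ scalerA. Qed.

Lemma sepscale1 q : left_id 1 (@sepscale q).
Proof. by move=> u; rewrite -(sepreprK u) !seppiZ scale1r. Qed.

Lemma sepscaleDr q : right_distributive (@sepscale q) +%R.
Proof.
by move=> a u v; rewrite -(sepreprK u) -(sepreprK v) -seppiD !seppiZ -seppiD scalerDr.
Qed.

Lemma sepscaleDl q (u : sepspace q) : {morph (@sepscale q)^~ u : a b / a + b}.
Proof. by move=> a b; rewrite -(sepreprK u) !seppiZ -seppiD scalerDl. Qed.

HB.instance Definition _ q := GRing.Zmodule_isLmodule.Build K (sepspace q)
  (@sepscaleA q) (@sepscale1 q) (@sepscaleDr q) (@sepscaleDl q).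

Definition sepnorm q (u : sepspace q) : K := of_real (q (seprepr u)).

Lemma sepnorm_pi q x : sepnorm (seppi q x) = of_real (q x).
Proof.
congr of_real; have /seppi_eq h := sepreprK (seppi q x).
by apply/eqP; rewrite -subr_eq0 -normr_le0 -h seminorm_dist.
Qed.

Lemma sepnormD q (u v : sepspace q) : sepnorm (u + v) <= sepnorm u + sepnorm v.
Proof.
rewrite -(sepreprK u) -(sepreprK v) -seppiD !sepnorm_pi -of_realD of_real_le.
exact: seminormD.
Qed.

Lemma sepnormZ q a (u : sepspace q) : sepnorm (a *: u) = `|a| * sepnorm u.
Proof.
rewrite -(sepreprK u) [_ *: _]seppiZ !sepnorm_pi -rnormE -of_realM.
by rewrite seminormZ.
Qed.

Lemma sepnorm_eq0 q (u : sepspace q) : sepnorm u = 0 -> u = 0.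
Proof.
rewrite -(sepreprK u) sepnorm_pi -of_real0 => /of_real_inj qu.
have -> : 0 = seppi q 0 by rewrite /seppi raddf0.
by apply/seppi_eq; rewrite subr0.
Qed.

HB.instance Definition _ q := Lmodule_isNormed.Build K (sepspace q)
  (@sepnormD q) (@sepnormZ q) (@sepnorm_eq0 q).

Lemma seppi_is_linear q : linear (seppi q).
Proof. by move=> a x y; rewrite seppiD -seppiZ. Qed.
HB.instance Definition _ q :=
  GRing.isLinear.Build K V (sepspace q) *:%R (seppi q) (@seppi_is_linear q).

Lemma rnorm_seppi q x : rnorm (seppi q x) = q x.
Proof. by rewrite /rnorm [`|_|]sepnorm_pi of_realK. Qed.

End SeminormTheory.

Section Completion.
Context {R : realType} {k : scalar_field} {V : lmodType (scalars R k)}.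
Local Notation K := (scalars R k).
Implicit Types q : seminorm V.

Definition cauchy_seq q : {pred nat -> V} := fun u =>
  `[< forall e : R, 0 < e -> exists N, forall m n,
      (N <= m)%N -> (N <= n)%N -> q (u m - u n) < e >].

Lemma cauchy_seq_submod_closed q : submod_closed (cauchy_seq q).
Proof.
split.
  apply/asboolP => e e0; exists 0%N => m n _ _ /=.
  by rewrite subrr seminorm0.
move=> a u v /asboolP cu /asboolP cv; apply/asboolP => e e0.
have a0 : 0 < rnorm a + 1 by rewrite ltr_wpDl// rnorm_ge0.
have [|M cM] := cu (e / 2 / (rnorm a + 1)); first by rewrite !divr_gt0.
have [|N cN] := cv (e / 2); first by rewrite divr_gt0.
exists (maxn M N) => m n; rewrite !geq_max => /andP[Mm Nm] /andP[Mn Nn].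
have -> : (a *: u + v) m - (a *: u + v) n = a *: (u m - u n) + (v m - v n).
  by rewrite scalerBr !opprD addrACA.
rewrite (le_lt_trans (seminormD _ _ _))// seminormZ [ltRHS]splitr.
rewrite ler_ltD ?cN//.
rewrite (@le_trans _ _ ((rnorm a + 1) * q (u m - u n)))//.
  by rewrite ler_wpM2r ?seminorm_ge0// lerDl.
by rewrite mulrC -ler_pdivlMr// ltW// cM.
Qed.

HB.instance Definition _ q :=
  GRing.isSubmodClosed.Build _ _ (cauchy_seq q) (cauchy_seq_submod_closed q).

Definition cauchy_space q : Type := {u : nat -> V | u \in cauchy_seq q}.
HB.instance Definition _ q := [isSub for @sval _ _ : cauchy_space q -> nat -> V].
HB.instance Definition _ q := [Choice of cauchy_space q by <:].
HB.instance Definition _ q := [SubChoice_isSubLmodule of cauchy_space q by <:].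

Definition lim_norm q (u : cauchy_space q) : R :=
  limn (fun n => q (val u n)).

Lemma lim_norm_cvg q (u : cauchy_space q) :
  (fun n => q (val u n)) @ \oo --> lim_norm u.
Proof.
apply/cauchy_cvgP/cauchy_exP => e e0.
have [N cN] := asboolP _ (valP u) e e0.
exists (q (val u N)); exists N => // n Nn; rewrite /ball /=.
by rewrite (le_lt_trans (seminorm_dist _ _ _))// cN//=.
Qed.

Lemma lim_normD q (u v : cauchy_space q) :
  lim_norm (u + v) <= lim_norm u + lim_norm v.
Proof.
rewrite /lim_norm -limD; [|exact: lim_norm_cvg..].
apply: ler_lim; first exact: lim_norm_cvg.
  by apply: is_cvgD; exact: lim_norm_cvg.
by near=> n; exact: seminormD.
Unshelve. all: by end_near. Qed.

Lemma lim_normZ q a (u : cauchy_space q) :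
  lim_norm (a *: u) = rnorm a * lim_norm u.
Proof.
rewrite /lim_norm.
under [in LHS]eq_fun do rewrite seminormZ.
by rewrite limM//; [rewrite lim_cst|exact: is_cvg_cst|exact: lim_norm_cvg].
Qed.

Definition lim_seminorm q : seminorm (cauchy_space q) :=
  Seminorm (@lim_normD q) (@lim_normZ q).

(** The completion of (V, q): Cauchy sequences modulo those tending to 0 for q.
    No injectivity of V -> completion q is built in; it holds iff q is a norm. *)
Definition completion q : Type := sepspace (lim_seminorm q).
HB.instance Definition _ q := NormedModule.on (completion q).

Lemma cauchy_cst q (x : V) : (fun _ : nat => x) \in cauchy_seq q.
Proof.
by apply/asboolP => e e0; exists 0%N => m n _ _; rewrite subrr seminorm0.
Qed.

Definition cst_cauchy q (x : V) : cauchy_space q :=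
  exist _ (fun=> x) (cauchy_cst q x).

Definition to_completion q (x : V) : completion q :=
  seppi (lim_seminorm q) (cst_cauchy q x).

Lemma to_completion_is_linear q : linear (to_completion q).
Proof.
move=> a x y; rewrite /to_completion -linearP; congr seppi.
exact: val_inj.
Qed.
HB.instance Definition _ q := GRing.isLinear.Build K V (completion q) *:%R
  (to_completion q) (@to_completion_is_linear q).

Lemma rnorm_to_completion q x : rnorm (to_completion q x) = q x.
Proof. by rewrite rnorm_seppi /= /lim_norm /= lim_cst. Qed.

End Completion.

Definition multilinear {K : nzRingType} {n : nat} {X Y : lmodType K}
    (A : ('I_n -> X) -> Y) : Prop :=
  forall (i : 'I_n) (x : 'I_n -> X), linear (fun u => A (dfwith x i u)).

(** Symmetric tensor powers.  As in Ryan's book, the algebraic tensor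
    x_1 (x) ... (x) x_n is the functional A |-> A(x_1, ..., x_n) on the space
    of all n-linear forms on X. *)
Section SymmetricTensors.
Context {R : realType} {k : scalar_field} (n : nat).
Local Notation K := (scalars R k).

Definition mform (X : lmodType K) : Type :=
  {A : ('I_n -> X) -> K | multilinear A}.

Definition tensor_pow {X : lmodType K} (x : X) : mform X -> K :=
  fun A => sval A (fun=> x).

Definition sym_tensor_pred (X : lmodType K) : {pred mform X -> K} := fun th =>
  `[< exists (m : nat) (l : 'I_m -> K) (x : 'I_m -> X),
      th = \sum_(i < m) l i *: tensor_pow (x i) >].
Arguments sym_tensor_pred : clear implicits.

Section Algebraic.
Variable X : lmodType K.

Lemma sym_tensor_submod_closed : submod_closed (sym_tensor_pred X).
Proof.
split.
  by apply/asboolP; exists 0%N, (fun=> 0), (fun=> 0); rewrite big_ord0.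
move=> a u v /asboolP[m1 [l1 [x1 ->]]] /asboolP[m2 [l2 [x2 ->]]].
apply/asboolP; exists (m1 + m2)%N.
exists (fun i => match fintype.split i with inl j => a * l1 j | inr j => l2 j end).
exists (fun i => match fintype.split i with inl j => x1 j | inr j => x2 j end).
rewrite big_split_ord/= scaler_sumr; congr (_ + _); apply: eq_bigr => i _.
  by rewrite (unsplitK (inl i)) scalerA.
by rewrite (unsplitK (inr i)).
Qed.

HB.instance Definition _ :=
  GRing.isSubmodClosed.Build _ _ (sym_tensor_pred X) sym_tensor_submod_closed.

Definition sym_tensor : Type := {th : mform X -> K | th \in sym_tensor_pred X}.
HB.instance Definition _ := [isSub for @sval _ _ : sym_tensor -> (mform X -> K)].
HB.instance Definition _ := [Choice of sym_tensor by <:].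
HB.instance Definition _ := [SubChoice_isSubLmodule of sym_tensor by <:].

Lemma tensor_pow_sym x : tensor_pow x \in sym_tensor_pred X.
Proof.
by apply/asboolP; exists 1%N, (fun=> 1), (fun=> x); rewrite big_ord1 scale1r.
Qed.

Definition sym_pow (x : X) : sym_tensor := exist _ (tensor_pow x) (tensor_pow_sym x).

End Algebraic.

Section Projective.
Variable X : normedModType K.
Implicit Types th : sym_tensor X.

Definition pi_s_set th : set R :=
  [set r | exists (m : nat) (l : 'I_m -> K) (x : 'I_m -> X),
    th = \sum_(i < m) l i *: sym_pow (x i) /\
    r = \sum_(i < m) rnorm (l i) * rnorm (x i) ^+ n].

Definition pi_s th : R := inf (pi_s_set th).

Lemma pi_s_set_ge0 th r : pi_s_set th r -> 0 <= r.
Proof.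
move=> [m [l [x [_ ->]]]]; apply: sumr_ge0 => i _.
by rewrite mulr_ge0 ?exprn_ge0 ?rnorm_ge0.
Qed.

Lemma pi_s_set_neq0 th : pi_s_set th !=set0.
Proof.
have /asboolP[m [l [x thE]]] := valP th.
exists (\sum_(i < m) rnorm (l i) * rnorm (x i) ^+ n), m, l, x; split => //.
apply: val_inj; rewrite raddf_sum [LHS]thE; apply: eq_bigr => i _.
by [].
Qed.

Lemma pi_s_set_has_inf th : has_inf (pi_s_set th).
Proof.
by split; [exact: pi_s_set_neq0|exists 0 => r; exact: pi_s_set_ge0].
Qed.

Lemma pi_s_ge0 th : 0 <= pi_s th.
Proof. by apply: lb_le_inf (pi_s_set_neq0 _) _ => r /pi_s_set_ge0. Qed.

Lemma pi_s_lb th r : pi_s_set th r -> pi_s th <= r.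
Proof. by apply: ge_inf; exists 0 => s /pi_s_set_ge0. Qed.

Lemma pi_sD th1 th2 : pi_s (th1 + th2) <= pi_s th1 + pi_s th2.
Proof.
rewrite -lerBlDr; apply: (lb_le_inf (pi_s_set_neq0 th1)).
move=> _ [m1 [l1 [x1 [e1 ->]]]].
rewrite lerBlDr -lerBlDl.
apply: (lb_le_inf (pi_s_set_neq0 th2)) => _ [m2 [l2 [x2 [e2 ->]]]].
rewrite lerBlDl; apply: pi_s_lb.
exists (m1 + m2)%N.
exists (fun i => match fintype.split i with inl j => l1 j | inr j => l2 j end).
exists (fun i => match fintype.split i with inl j => x1 j | inr j => x2 j end).
rewrite e1 e2 !big_split_ord/=; split; congr (_ + _); apply: eq_bigr => i _;
  by rewrite ?(unsplitK (inl i)) ?(unsplitK (inr i)).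
Qed.

Lemma pi_sZ_le a th : pi_s (a *: th) <= rnorm a * pi_s th.
Proof.
have h r : pi_s_set th r -> pi_s (a *: th) <= rnorm a * r.
  move=> [m [l [x [-> ->]]]]; apply: pi_s_lb.
  exists m, (fun i => a * l i), x; split.
    by rewrite scaler_sumr; apply: eq_bigr => i _; rewrite scalerA.
  by rewrite mulr_sumr; apply: eq_bigr => i _; rewrite rnormM mulrA.
have [a0|a0] := eqVneq (rnorm a) 0.
  by have [r /h] := pi_s_set_neq0 th; rewrite a0 !mul0r.
have {}a0 : 0 < rnorm a by rewrite lt_neqAle eq_sym a0 rnorm_ge0.
rewrite mulrC -ler_pdivrMr//; apply: (lb_le_inf (pi_s_set_neq0 th)) => r /h.
by rewrite ler_pdivrMr// mulrC.
Qed.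

Lemma pi_sZ a th : pi_s (a *: th) = rnorm a * pi_s th.
Proof.
apply/le_anti; rewrite pi_sZ_le/=.
have [->|a0] := eqVneq a 0; first by rewrite rnorm0 mul0r pi_s_ge0.
have ra0 : 0 < rnorm a.
  rewrite lt_neqAle rnorm_ge0 andbT eq_sym.
  by apply: contra a0 => /eqP/rnorm_eq0 ->.
have := pi_sZ_le a^-1 (a *: th).
by rewrite scalerA mulVf// scale1r rnormV ler_pdivlMl.
Qed.

Definition pi_seminorm : seminorm (sym_tensor X) := Seminorm pi_sD pi_sZ.

Definition proj_sym_tensor : Type := completion pi_seminorm.
HB.instance Definition _ := NormedModule.on proj_sym_tensor.

Definition delta (x : X) : proj_sym_tensor := to_completion pi_seminorm (sym_pow x).

End Projective.
End SymmetricTensors.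
Arguments delta {R k} n X x : rename.

(** L_p(mu) for scalar-valued functions, 1 <= p < oo. *)
Section Lp.
Context {R : realType} {k : scalar_field} {d} {T : measurableType d}.
Variable mu : {measure set T -> \bar R}.
Local Notation K := (scalars R k).
Implicit Types f g : T -> K.

Definition measurable_scalar f : Prop :=
  measurable_fun setT (sRe \o f) /\ measurable_fun setT (sIm \o f).

Lemma measurable_scalar0 : measurable_scalar 0.
Proof. by rewrite /measurable_scalar; case: (k); split; exact: measurable_cst. Qed.

Lemma measurable_scalar_lin a f g :
  measurable_scalar f -> measurable_scalar g -> measurable_scalar (a *: f + g).
Proof.
rewrite /measurable_scalar; case: (k) f g a => f g a [mf mf'] [mg mg']; split.
- exact: (measurable_funD (measurableT_comp (@mulrl_measurable R setT a) mf) mg).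
- exact: measurable_cst.
- case: a => a b.
  rewrite [X in measurable_fun _ X](_ : _ =
    (fun x => a * complex.Re (f x) - b * complex.Im (f x) + complex.Re (g x))).
    apply: measurable_funD => //; apply: measurable_funB.
      by apply: (measurableT_comp (@mulrl_measurable R setT a)).
    by apply: (measurableT_comp (@mulrl_measurable R setT b)).
  apply/funext => x /=; rewrite !fctE /=.
  by case: (f x) => ? ?; case: (g x).
- case: a => a b.
  rewrite [X in measurable_fun _ X](_ : _ =
    (fun x => a * complex.Im (f x) + b * complex.Re (f x) + complex.Im (g x))).
    apply: measurable_funD => //; apply: measurable_funD.
      by apply: (measurableT_comp (@mulrl_measurable R setT a)).
    by apply: (measurableT_comp (@mulrl_measurable R setT b)).
  apply/funext => x /=; rewrite !fctE /=.
  by case: (f x) => ? ?; case: (g x).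
Qed.

Lemma measurable_rnorm f : measurable_scalar f -> measurable_fun setT (rnorm \o f).
Proof.
rewrite /measurable_scalar; case: (k) f => f [mf mf'].
  exact: (measurableT_comp (@normr_measurable R setT)).
rewrite [X in measurable_fun _ X](_ : _ = fun x =>
    ((complex.Re (f x)) ^+ 2 + (complex.Im (f x)) ^+ 2) `^ 2^-1).
  apply: (measurableT_comp (measurable_powR _ )).
  by apply: measurable_funD; apply: measurable_funX.
apply/funext => x; rewrite powR12_sqrt ?addr_ge0 ?sqr_ge0//.
exact: (f_equal (@complex.Re R) (normc_def (f x : R[i]))).
Qed.

Definition Lp_norm (p : R) f : \bar R := ('N[mu]_p%:E[EFin \o (rnorm \o f)])%E.

Section normed.
Variables (p : R) (p1 : 1 <= p).

Let p0 : 0 < p. Proof. exact: lt_le_trans p1. Qed.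

Let measurable_powR_norm (h : T -> R) : measurable_fun setT h ->
  measurable_fun setT (fun x => `|(h x)%:E| `^ p)%E.
Proof.
move=> mh; apply/measurable_EFinP.
apply: (measurableT_comp (measurable_powR _)).
exact: (measurableT_comp (@normr_measurable R setT)).
Qed.

Lemma Lp_norm0 : Lp_norm p 0 = 0%E.
Proof.
rewrite /Lp_norm [X in Lnorm _ _ X](_ : _ = cst 0%E).
  by rewrite Lnorm0// eqe gt_eqF.
by apply/funext => x /=; rewrite rnorm0.
Qed.

Lemma Lp_normD f g : measurable_scalar f -> measurable_scalar g ->
  (Lp_norm p (f + g)%R <= Lp_norm p f + Lp_norm p g)%E.
Proof.
move=> mf mg.
have mfg : measurable_scalar (f + g).
  by rewrite -[f]scale1r; exact: measurable_scalar_lin.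
move/measurable_rnorm in mf; move/measurable_rnorm in mg.
move/measurable_rnorm in mfg.
apply: le_trans (minkowski_EFin mu mf mg p1).
rewrite /Lp_norm unlock /=; apply: gt0_ler_poweR.
- by rewrite invr_ge0 ltW.
- by rewrite in_itv/= leey andbT; apply: integral_ge0 => x _; rewrite /= ?lee_fin ?poweR_ge0 ?powR_ge0.
- by rewrite in_itv/= leey andbT; apply: integral_ge0 => x _; rewrite /= ?lee_fin ?poweR_ge0 ?powR_ge0.
apply: ge0_le_integral => //.
- exact: measurable_powR_norm.
- by apply: measurable_powR_norm; exact: measurable_funD.
move=> x _; rewrite lee_fin ge0_ler_powR ?nnegrE// ?(ltW p0)//=.
by rewrite !ger0_norm ?addr_ge0 ?rnorm_ge0// rnormD.
Qed.

Lemma Lp_normZ a f : measurable_scalar f ->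
  (Lp_norm p (a *: f) = (rnorm a)%:E * Lp_norm p f)%E.
Proof.
move=> /measurable_rnorm mf; rewrite /Lp_norm unlock.
under eq_integral => x _.
  rewrite /= [rnorm _](rnormZ a (f x)) normrM powRM// EFinM.
  rewrite (ger0_norm (rnorm_ge0 a)).
over.
rewrite ge0_integralZl//.
- rewrite poweRM//; last by apply: integral_ge0 => x _; rewrite /= ?lee_fin ?poweR_ge0 ?powR_ge0.
    by rewrite poweR_EFin -powRrM mulfV ?gt_eqF// powRr1// rnorm_ge0.
  by rewrite lee_fin powR_ge0.
- exact: (measurable_powR_norm mf).
- by rewrite lee_fin powR_ge0.
Qed.

Definition Lp_pred of 1 <= p : {pred T -> K} := fun f =>
  `[< measurable_scalar f /\ (Lp_norm p f < +oo)%E >].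

Lemma Lp_submod_closed : submod_closed (Lp_pred p1).
Proof.
split.
  by apply/asboolP; split; [exact: measurable_scalar0|rewrite Lp_norm0 ltry].
move=> a f g /asboolP[mf fp] /asboolP[mg gp]; apply/asboolP.
split; first exact: measurable_scalar_lin.
have maf : measurable_scalar (a *: f).
  rewrite -[_ *: _]addr0; apply: measurable_scalar_lin => //.
  exact: measurable_scalar0.
rewrite (le_lt_trans (Lp_normD maf mg))// lte_add_pinfty// Lp_normZ//.
by rewrite lte_mul_pinfty// lee_fin rnorm_ge0.
Qed.

HB.instance Definition _ :=
  GRing.isSubmodClosed.Build _ _ (Lp_pred p1) Lp_submod_closed.

Definition Lp_fun : Type := {f : T -> K | f \in Lp_pred p1}.
HB.instance Definition _ := [isSub for @sval _ _ : Lp_fun -> (T -> K)].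
HB.instance Definition _ := [Choice of Lp_fun by <:].
HB.instance Definition _ := [SubChoice_isSubLmodule of Lp_fun by <:].

Definition Lp_fun_norm (f : Lp_fun) : R := fine (Lp_norm p (val f)).

Lemma Lp_fun_normE (f : Lp_fun) : (Lp_fun_norm f)%:E = Lp_norm p (val f).
Proof.
have /asboolP[_ fy] := valP f.
by rewrite /Lp_fun_norm fineK// ge0_fin_numE// Lnorm_ge0.
Qed.

Lemma Lp_fun_normD (f g : Lp_fun) :
  Lp_fun_norm (f + g) <= Lp_fun_norm f + Lp_fun_norm g.
Proof.
have /asboolP[mf _] := valP f; have /asboolP[mg _] := valP g.
by rewrite -lee_fin EFinD !Lp_fun_normE; exact: Lp_normD.
Qed.

Lemma Lp_fun_normZ a (f : Lp_fun) :
  Lp_fun_norm (a *: f) = rnorm a * Lp_fun_norm f.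
Proof.
have /asboolP[mf _] := valP f.
by apply: EFin_inj; rewrite EFinM !Lp_fun_normE; exact: Lp_normZ.
Qed.

Definition Lp_seminorm : seminorm Lp_fun := Seminorm Lp_fun_normD Lp_fun_normZ.

(** The functions of norm 0 are those vanishing mu-almost everywhere. *)
Definition Lp : Type := sepspace Lp_seminorm.
HB.instance Definition _ := NormedModule.on Lp.

End normed.
End Lp.
Arguments Lp_fun {R} k {d T} mu {p} p1.
Arguments Lp {R} k {d T} mu {p} p1.

Lemma opnorm_has_sup (R : realType) (k : scalar_field)
    (X Y : normedModType (scalars R k)) (f : X -> Y) :
  linear f -> continuous f ->
  has_sup [set rnorm (f x) | x in [set x | rnorm x <= 1]].
Proof.
move=> lf cf; split; first by exists (rnorm (f 0)), 0 => //=; rewrite rnorm0.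
pose F : {linear X -> Y} := HB.pack f (GRing.isLinear.Build _ _ _ _ f lf).
have /linear_bounded_continuous/linear_boundedP : continuous F by [].
move=> /pinfty_ex_gt0[r r0 fr]; exists (sRe r) => _ [x /= x1 <-].
rewrite -(@of_real_le R k) rnormE (of_real_sRe (ltW r0)).
apply: le_trans (fr x) _.
by rewrite ler_piMr ?(ltW r0)// -rnormE -(@of_real1 R k) of_real_le.
Qed.

Lemma rnorm_le_opnorm (R : realType) (k : scalar_field)
    (X Y : normedModType (scalars R k)) (f : X -> Y) x :
  linear f -> continuous f -> rnorm (f x) <= opnorm f * rnorm x.
Proof.
move=> lf cf; have sf := opnorm_has_sup lf cf.
pose F : {linear X -> Y} := HB.pack f (GRing.isLinear.Build _ _ _ _ f lf).
have [x0|x0] := eqVneq (rnorm x) 0.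
  rewrite x0 mulr0 (rnorm_eq0 x0) -[f]/(F : X -> Y) linear0.
  by rewrite rnorm0.
have {}x0 : 0 < rnorm x by rewrite lt_neqAle eq_sym x0 rnorm_ge0.
rewrite -ler_pdivrMr//.
pose a : scalars R k := of_real (rnorm x)^-1.
have na : rnorm a = (rnorm x)^-1.
  rewrite /rnorm ger0_norm ?of_realK//.
  by rewrite -(@of_real0 R k) of_real_le invr_ge0 ltW.
apply: sup_ubound; first exact: (proj2 sf).
exists (a *: x) => /=; first by rewrite rnormZ na mulVf// gt_eqF.
by rewrite -[f]/(F : X -> Y) linearZ rnormZ na mulrC.
Qed.

Section DualBall.
Context {R : realType} {k : scalar_field} (E : normedModType (scalars R k)).
Local Notation K := (scalars R k).

Definition cont_dual : set (E -> K) := [set f | linear f /\ continuous f].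

(** The topology of the closed unit ball of E' inherited from {ptws E -> K}
    (pointwise convergence on E) is the weak* topology. *)
Definition dual_ball_set : set {ptws E -> K} :=
  [set f | cont_dual f /\ opnorm f <= 1].

Definition dual_ball : Type := set_type dual_ball_set.
HB.instance Definition _ := Topological.on dual_ball.

Lemma dual_ball_set0 : (fun=> 0 : K) \in dual_ball_set.
Proof.
apply/mem_set; split.
  split; first by move=> a x y; rewrite scaler0 addr0.
  exact: cst_continuous.
apply: ge_sup; first by exists 0, 0 => //=; rewrite rnorm0.
by move=> _ [x _ <-]; rewrite rnorm0.
Qed.

HB.instance Definition _ :=
  isPointed.Build dual_ball (exist _ (fun=> 0 : K) dual_ball_set0).

HB.instance Definition _ := @isMeasurable.Build default_measure_display dual_ball
  <<s @open dual_ball >> (@sigma_algebra0 _ _ _) (@sigma_algebraC _ _)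
  (@sigma_algebra_bigcup _ _ _).

Definition regular_measure (mu : {measure set dual_ball -> \bar R}) : Prop :=
  forall A, measurable A ->
    mu A = ereal_sup [set mu C | C in [set C | compact C /\ C `<=` A]] /\
    mu A = ereal_inf [set mu U | U in [set U | open U /\ A `<=` U]].

Definition eval_at (x : E) : dual_ball -> K := fun phi => set_val phi x.

Lemma eval_at_le x phi : rnorm (eval_at x phi) <= rnorm x.
Proof.
have [[lf cf] f1] := set_mem (valP phi).
by rewrite (le_trans (rnorm_le_opnorm _ lf cf))// ler_piMl ?rnorm_ge0.
Qed.

Lemma eval_at_continuous x : continuous (eval_at x).
Proof.
move=> phi.
apply: (@continuous_comp _ _ _ (set_val : dual_ball -> {ptws E -> K})
  (fun f : {ptws E -> K} => f x)).
  exact: initial_continuous.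
exact: (@proj_continuous _ (fun=> K) x).
Qed.

HB.instance Definition _ x :=
  @isContinuous.Build dual_ball K (eval_at x) (@eval_at_continuous x).

(** The isometry e of E into C(B_E'). *)
Definition emb_C (x : E) : continuousType dual_ball K := eval_at x.

Lemma continuous_measurable_scalar (f : dual_ball -> K) :
  continuous f -> measurable_scalar f.
Proof.
have h (g : dual_ball -> R) : continuous g -> measurable_fun setT g.
  move=> /continuousP cg.
  apply: (measurability _ (RGenOpens.measurableE R)).
  move=> _ [_ [a [b ->] <-]]; rewrite setTI.
  apply: sub_sigma_algebra; apply: cg; exact: interval_open.
have hc (r : K -> R) : (forall x y, `|r x - r y| <= rnorm (x - y)) -> continuous r.
  move=> rle x; apply/(@cvgrPdist_lt _ _ _ (nbhs x)) => eps eps0.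
  have eK : 0 < of_real eps :> K.
    rewrite lt_neqAle -(@of_real0 R k) of_real_le ltW// andbT.
    by apply: contraTN eps0 => /eqP/of_real_inj <-; rewrite ltxx.
  exists (of_real eps) => // y /= xy; apply: le_lt_trans (rle _ _) _.
  rewrite lt_neqAle -(@of_real_le R k) rnormE (ltW xy) andbT.
  by apply: contraTneq xy => <-; rewrite rnormE ltxx.
have cRe : continuous (@sRe R k : K -> R).
  apply: hc; case: (k) => x y; first exact: lexx.
  have := normc_ge_Re (x - y : R[i]); rewrite lecE => /andP[_].
  by case: x y => [a b] [c d].
have cIm : continuous (@sIm R k : K -> R).
  apply: hc; case: (k) => x y; first by rewrite subrr normr0 rnorm_ge0.
  have -> : rnorm (x - y) =
      Num.sqrt (complex.Re (x - y) ^+ 2 + complex.Im (x - y) ^+ 2).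
    exact: (f_equal (@complex.Re R) (normc_def (x - y : R[i]))).
  case: x y => [a b] [c d]; rewrite -sqrtr_sqr ler_wsqrtr//=.
  by rewrite lerDr sqr_ge0.
move=> cf; split; apply: h => phi.
  by apply: continuous_comp (cf phi) _; exact: cRe.
by apply: continuous_comp (cf phi) _; exact: cIm.
Qed.


End DualBall.
Arguments cont_dual {R k} E _ : rename.

Section PietschSpace.
Context {R : realType} {k : scalar_field} (E : normedModType (scalars R k)).
Local Notation K := (scalars R k).
Variables (mu : probability (dual_ball E) R) (p : R) (p1 : 1 <= p).

Definition emb_image : Type := set_type (range (@emb_C R k E)).

Definition emb (x : E) : emb_image :=
  exist _ (emb_C x) (mem_set (imageT (@emb_C R k E) x)).

Lemma emb_image_Lp (f : emb_image) : (set_val f : dual_ball E -> K) \in Lp_pred mu p1.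
Proof.
have p0 : 0 < p by exact: lt_le_trans p1.
have [x _ ex] := set_mem (valP f); rewrite -[set_val f]/(\val f) -ex.
have me : measurable_scalar (eval_at x).
  exact/continuous_measurable_scalar/eval_at_continuous.
apply/asboolP; split=> //; rewrite /Lp_norm unlock poweR_lty//.
move/measurable_rnorm : me => me.
apply: (@le_lt_trans _ _ (\int[mu]_phi (rnorm x `^ p)%:E)%E); last first.
  rewrite integral_cst//; apply: lte_mul_pinfty => //.
    by rewrite lee_fin powR_ge0.
  by apply: le_lt_trans (ltry 1); exact: (probability_le1 mu measurableT).
apply: ge0_le_integral => //=.
- apply/measurable_EFinP; apply: (measurableT_comp (measurable_powR _)).
  exact: (measurableT_comp (@normr_measurable R setT)).
- move=> phi _; rewrite lee_fin ge0_ler_powR ?nnegrE ?rnorm_ge0// ?(ltW p0)//.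
  by rewrite ger0_norm ?rnorm_ge0// eval_at_le.
Qed.

Definition emb_image_to_Lp (f : emb_image) : Lp_fun k mu p1 :=
  exist _ (set_val f : dual_ball E -> K) (emb_image_Lp f).

(** j_p^e, the canonical map C(B_E') -> L_p(mu) restricted to e(E). *)
Definition j_e (f : emb_image) : Lp k mu p1 :=
  seppi (Lp_seminorm mu p1) (emb_image_to_Lp f).

Lemma j_e_lin a x y :
  j_e (emb (a *: x + y)) = a *: j_e (emb x) + j_e (emb y).
Proof.
rewrite /j_e -linearP; congr seppi; apply: val_inj; apply/funext => phi.
have [[lphi _] _] := set_mem (valP phi).
exact: lphi.
Qed.

(** G_{E,p}^mu is the closure of j_p^e(e(E)) in L_p(mu). *)
Definition G_pred : {pred Lp k mu p1} := fun g =>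
  `[< closure (range (j_e \o emb)) g >].

Lemma G_submod_closed : submod_closed G_pred.
Proof.
have clP (g : Lp k mu p1) : closure (range (j_e \o emb)) g <->
    forall r : R, 0 < r -> exists x, rnorm (g - j_e (emb x)) < r.
  split=> [cg r r0|cg U].
    have rK : 0 < of_real r :> K by rewrite of_real_gt0.
    have [_ [[x _ <-]]] := cg _ (nbhsx_ballx g _ rK).
    by rewrite -ball_normE/= -rnormE of_real_lt; exists x.
  move=> /nbhs_ballP[r /= r0 Ug].
  have [|x xr] := cg (sRe r).
    by rewrite -(@of_real_lt R k) of_real0 of_real_sRe// ltW.
  exists (j_e (emb x)); split; first by exists x.
  apply: Ug; rewrite -ball_normE/= -rnormE -(of_real_sRe (ltW r0)).
  by rewrite of_real_lt.
split.
  apply/asboolP/subset_closure; exists 0 => //=.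
  have := j_e_lin (-1) 0 0.
  by rewrite scaler0 addr0 scaleN1r addNr.
move=> a g h /asboolP/clP cg /asboolP/clP ch; apply/asboolP/clP => r r0.
have a0 : 0 < rnorm a + 1 by rewrite ltr_wpDl// rnorm_ge0.
have [|x gx] := cg (r / 2 / (rnorm a + 1)); first by rewrite !divr_gt0.
have [|y hy] := ch (r / 2); first by rewrite divr_gt0.
exists (a *: x + y); rewrite j_e_lin.
have -> : a *: g + h - (a *: j_e (emb x) + j_e (emb y)) =
    a *: (g - j_e (emb x)) + (h - j_e (emb y)).
  by rewrite scalerBr opprD addrACA.
rewrite (le_lt_trans (rnormD _ _))// rnormZ [ltRHS]splitr ler_ltD//.
rewrite (@le_trans _ _ ((rnorm a + 1) * rnorm (g - j_e (emb x))))//.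
  by rewrite ler_wpM2r ?rnorm_ge0// lerDl.
by rewrite mulrC -ler_pdivlMr// ltW.
Qed.

HB.instance Definition _ :=
  GRing.isSubmodClosed.Build _ _ G_pred G_submod_closed.

Definition GEp : Type := {g : Lp k mu p1 | g \in G_pred}.
HB.instance Definition _ := [isSub for @sval _ _ : GEp -> Lp k mu p1].
HB.instance Definition _ := [Choice of GEp by <:].
HB.instance Definition _ := [SubChoice_isSubLmodule of GEp by <:].

Definition G_norm (g : GEp) : K := `|val g|.

Lemma G_normD g h : G_norm (g + h) <= G_norm g + G_norm h.
Proof. exact: ler_normD. Qed.

Lemma G_normZ a g : G_norm (a *: g) = `|a| * G_norm g.
Proof. exact: normrZ. Qed.

Lemma G_norm_eq0 g : G_norm g = 0 -> g = 0.
Proof. by move=> /normr0_eq0 g0; exact: val_inj. Qed.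

HB.instance Definition _ := Lmodule_isNormed.Build K GEp G_normD G_normZ G_norm_eq0.

Lemma rnorm_GEp (g : GEp) : rnorm g = rnorm (val g).
Proof. by []. Qed.

Lemma j_e_G (f : emb_image) : j_e f \in G_pred.
Proof.
apply/asboolP/subset_closure; have [x _ ef] := set_mem (valP f).
by exists x => //=; congr j_e; apply: val_inj.
Qed.

Definition j_e_to_G (f : emb_image) : GEp := exist _ (j_e f) (j_e_G f).

End PietschSpace.

Section Polynomials.
Context {R : realType} {k : scalar_field} {E F : normedModType (scalars R k)}.
Implicit Types P : E -> F.

Definition homogeneous_polynomial (n : nat) P : Prop :=
  exists A : ('I_n -> E) -> F, multilinear A /\ forall x, P x = A (fun=> x).

Definition weakly_summable (p : R) (x : nat -> E) : Prop :=
  forall f, cont_dual E f -> (\sum_(0 <= i <oo) (rnorm (f (x i)) `^ p)%:E < +oo)%E.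

Definition absolutely_summable (q : R) (y : nat -> F) : Prop :=
  (\sum_(0 <= i <oo) (rnorm (y i) `^ q)%:E < +oo)%E.

Definition dominated (n : nat) (p : R) P : Prop :=
  forall x : nat -> E,
    weakly_summable p x -> absolutely_summable (p / n%:R) (P \o x).

Definition domination (n : nat) (p : R) P
    (mu : probability (dual_ball E) R) (C : R) : Prop :=
  forall x, ((rnorm (P x))%:E <=
    C%:E * (\int[mu]_phi (rnorm (eval_at x phi) `^ p)%:E) `^ (n%:R / p))%E.

Definition dominated_norm (n : nat) (p : R) P : R :=
  inf [set C | 0 < C /\ exists mu : probability (dual_ball E) R,
                 regular_measure mu /\ domination n p P mu C].

End Polynomials.

Lemma exponent_ge1 (R : realType) (n : nat) (p : R) :
  (0 < n)%N -> n%:R <= p -> 1 <= p.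
Proof. by move=> n0; apply: le_trans; rewrite ler1n. Qed.

(* Main.v *)
Require Import Defs.
From HB Require Import structures.
From mathcomp Require Import all_boot all_order all_algebra.
From mathcomp Require Import complex.
From mathcomp Require Import all_classical all_reals all_analysis.
From mathcomp Require Import measurable_realfun.
From mathcomp Require Import ring lra.
Import Order.TTheory GRing.Theory Num.Theory.
Import numFieldNormedType.Exports.
Local Open Scope classical_set_scope.
Local Open Scope ring_scope.
Set Implicit Arguments.
Unset Strict Implicit.
Unset Printing Implicit Defensive.

(** The proof rests on a third property, between domination by a measure and
    factorization: the inequality
    [\sum |P x| ^ (p/n) <= D sup_phi \sum |phi x| ^ p] for all finite families of
    vectors ([family_domination]).

    If [P] is dominated, some finite [D] works: otherwise finite families that
    violate the inequality by larger and larger factors could be rescaled and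
    glued into a weakly [p]-summable sequence whose image is not summable
    ([dominated_family]).  The Pietsch argument turns the inequality into a
    regular probability [mu] ([pietsch_domination]).  The functions
    [|P x| ^ (p/n) - D |phi x| ^ p] on the dual ball generate a convex cone that
    contains no function with a positive lower bound, and Hahn-Banach gives a
    positive functional on continuous functions that is nonpositive on this cone.
    The dual ball is compact and Hausdorff for the weak-star topology, so this
    functional is dominated by the integral of a regular measure
    ([riesz_dual_ball], built from an outer measure on open sets).  Conversely,
    domination by [mu] with constant [C] gives the inequality with
    [D = C ^ (p/n)] by integrating over [mu], and the inequality gives dominated
    polynomials because a weakly summable sequence has uniformly bounded sums over
    the dual ball ([weakly_summable_bounded]).

    Working with finite families also shows that the dominated norm [d] is
    attained: the inequality passes to the infimum of the constants, and
    Pietsch's argument applied to the limit inequality yields one measure with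
    constant [d] ([family_domination_norm]).

    Domination by [mu] says that [|P x| <= C |T x| ^ n], where
    [T : E -> G] is the map into the Pietsch space.  Polarization transfers this
    bound to the symmetric multilinear form of [P], which makes [P] uniformly
    continuous on bounded sets for the seminorm [|T x|]; so [P] extends to an
    [n]-homogeneous polynomial [Q] on [G] with [|Q g| <= C |g| ^ n]
    ([extension_polynomial]).  The linear map [v] sends [\sum c_i g_i ^ n] to
    [\sum c_i Q g_i].  It is well defined because the tensor determines the value
    of each scalar form [l \o A], where [A] is multilinear with diagonal [Q] and
    [l] is any linear functional, and such functionals separate points
    ([linear_functional_separates]).  It is bounded by [C] for the projective norm,
    hence extends to the completion ([polynomial_linearization]).  In the other
    direction a factorization through [v] gives domination with constant
    [opnorm v] ([factorization_domination]).  With [C = d] this yields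
    [opnorm v <= d], and the definition of [d] as an infimum gives
    [d <= opnorm v]. *)

(** * Separating functionals and the Hahn-Banach theorem *)
(** A subspace [W] that is maximal among those avoiding [y] is a hyperplane: by
    maximality every vector is congruent modulo [W] to a unique multiple of
    [y], and [l] reads off the coefficient.  No continuity is asked for, since
    symmetric tensors are tested against all multilinear forms. *)
Lemma linear_functional_separates (K : fieldType) (V : lmodType K) (y : V) :
  y != 0 -> exists l : V -> K,
    (forall a u v, l (a *: u + v) = a * l u + l v) /\ l y = 1.
Proof.
move=> y0.
pose S : set (set V) := [set W | (forall a u v, W u -> W v -> W (a *: u + v)) /\ ~ W y].
have Zs (F : set (set V)) : F `<=` S -> total_on F subset -> S (\bigcup_(X in F) X).
  move=> FS Ft; split; last by move=> [X /FS[_ nXy] /nXy].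
  move=> a u v [X FX Xu] [Y FY Yv].
  have [XY|YX] := Ft _ _ FX FY.
  - by exists Y => //; have [+ _] := FS _ FY; apply => //; exact: XY.
  - by exists X => //; have [+ _] := FS _ FX; apply => //; exact: YX.
have [W [[lW nWy] maxW]] := Zorn_bigcup Zs.
have W0 : W 0.
  (* The empty set is closed under linear combinations; maximality excludes it. *)
  apply: contrapT => nW0.
  have We u : ~ W u.
    by move=> Wu; apply: nW0; have := lW (-1) u u Wu Wu; rewrite scaleN1r addNr.
  have : W `<` [set 0] by split; [move=> u /We | move=> /(_ 0 erefl)].
  move=> /maxW; apply; split=> [a u v -> -> /=|]; first by rewrite scaler0 addr0.
  by move/eqP; exact/negP.
have WZ a u : W u -> W (a *: u) by move=> Wu; rewrite -[_ *: _]addr0; exact: lW.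
have WD u v : W u -> W v -> W (u + v).
  by move=> Wu Wv; rewrite -[u]scale1r; exact: lW.
have WN u : W u -> W (- u) by move=> /(WZ (-1)); rewrite scaleN1r.
have WK u c : W (u - c *: y) -> forall c', W (u - c' *: y) -> c = c'.
  move=> h c' h'; apply/eqP; rewrite eq_sym -subr_eq0; apply/negPn/negP => cc.
  apply: nWy; rewrite -[y]scale1r -(mulVf cc) -scalerA; apply: WZ.
  have := WD _ _ h (WN _ h'); rewrite opprB addrC addrA subrK.
  by rewrite scalerBl.
have ex u : exists c, W (u - c *: y).
  apply: contrapT => /forallNP nu.
  pose W' := [set w | exists c, W (w - c *: u)].
  have : W `<` W'.
    split=> [w Ww|/(_ u)].
      by exists 0; rewrite scale0r subr0.
    move=> /(_ _)/wrap[]; first by exists 1; rewrite scale1r subrr.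
    by move=> Wu; apply: (nu 0); rewrite scale0r subr0.
  move=> /maxW; apply; split.
    move=> a v w [c vc] [d wd]; exists (a * c + d).
    have := lW a _ _ vc wd; rewrite scalerBr addrACA -opprD scalerA -scalerDl.
    by [].
  move=> [c yc]; have [c0|c0] := eqVneq c 0.
    by move: yc; rewrite c0 scale0r subr0.
  apply: (nu c^-1); have := WN _ (WZ c^-1 _ yc).
  by rewrite scalerBr scalerA mulVf// scale1r opprB.
pose l u := projT1 (cid (ex u)).
have lP u : W (u - l u *: y) by exact: (projT2 (cid (ex u))).
exists l; split.
  move=> a u v; apply: (WK (a *: u + v)); first exact: lP.
  have := lW a _ _ (lP u) (lP v).
  by rewrite scalerBr addrACA -opprD scalerA -scalerDl.
by apply: (WK y); [exact: lP | rewrite scale1r subrr].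
Qed.

Section HahnBanach.
Context {R : realType} {V : lmodType R}.
Implicit Types q s : V -> R.

(** Only positive factors and one inequality in the homogeneity clause: the other
    inequality follows by scaling back. *)
Definition sublinear q :=
  (forall x y, q (x + y) <= q x + q y) /\
  (forall t x, 0 < t -> q (t *: x) <= t * q x).

Lemma sublinear0 q : sublinear q -> q 0 = 0.
Proof.
move=> [_ qZ]; have := qZ 2 0; have := qZ 2^-1 0.
rewrite !scaler0 invr_gt0 ltr0n => /(_ isT) h1 /(_ isT) h2.
by apply/eqP; rewrite eq_le; apply/andP; split; lra.
Qed.

Lemma sublinear_geN q x : sublinear q -> - q (- x) <= q x.
Proof.
move=> qs; have := qs.1 x (- x); rewrite subrr sublinear0//.
by rewrite -lerBlDr sub0r.
Qed.

(** The common shape of the three infima used below: a chain of sublinear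
    functionals, the perturbation of a minimal one in a direction, and the
    functional of the Pietsch argument. *)
Lemma inf_sublinear (S : V -> set R) :
  (forall x, has_inf (S x)) ->
  (forall x y a b, S x a -> S y b -> exists2 c, S (x + y) c & c <= a + b) ->
  (forall t x a, 0 < t -> S x a -> exists2 c, S (t *: x) c & c <= t * a) ->
  sublinear (fun x => inf (S x)).
Proof.
move=> Sinf SD SZ; split=> [x y|t x t0].
  rewrite -lerBlDr; apply: lb_le_inf; first exact: (Sinf x).1.
  move=> a Sa; rewrite lerBlDr -lerBlDl.
  apply: lb_le_inf; first exact: (Sinf y).1.
  move=> b Sb; rewrite lerBlDl; have [c Sc cab] := SD _ _ _ _ Sa Sb.
  by apply: le_trans cab; apply: ge_inf => //; exact: (Sinf _).2.
rewrite mulrC -ler_pdivrMr//; apply: lb_le_inf; first exact: (Sinf x).1.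
move=> a Sa; rewrite ler_pdivrMr// mulrC.
have [c Sc ca] := SZ _ _ _ t0 Sa; apply: le_trans ca.
by apply: ge_inf => //; exact: (Sinf _).2.
Qed.

(** Zorn's lemma for the reversed pointwise order.  The infimum of a chain is
    finite because a sublinear [q] below [s] satisfies
    [q x >= - q (- x) >= - s (- x)]. *)
Lemma minimal_sublinear s : sublinear s ->
  exists q, [/\ sublinear q, forall x, q x <= s x &
    forall q', sublinear q' -> (forall x, q' x <= q x) -> q' = q].
Proof.
move=> ss.
pose below q := sublinear q /\ forall x, q x <= s x.
pose T := {q | below q}.
pose Rl (a b : T) : bool := `[< forall x, sval b x <= sval a x >].
have [| | | |[q [qs qles]] qmin] := @Zorn T Rl.
- by move=> t; apply/asboolP.
- move=> r u t /asboolP ru /asboolP ut; apply/asboolP => x.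
  exact: le_trans (ut x) (ru x).
- move=> [u pu] [t pt] /asboolP /= ut /asboolP /= tu.
  apply: eq_exist => /=.
  by apply/funext => x; apply/eqP; rewrite eq_le ut tu.
- move=> A Atot.
  have [[a0 Aa0]|A0] := pselect (exists a, A a); last first.
    by exists (exist below s (conj ss (fun=> lexx _))) => a Aa; exfalso; apply: A0; exists a.
  pose S x := [set sval a x | a in A].
  have Sinf x : has_inf (S x).
    split; first by exists (sval a0 x), a0.
    exists (- s (- x)) => _ [a Aa <-]; have [asub ales] := svalP a.
    by rewrite (le_trans _ (sublinear_geN x asub))// lerN2.
  have qsub : sublinear (fun x => inf (S x)).
    apply: inf_sublinear => //.
    - move=> x y _ _ [a Aa <-] [b Ab <-].
      have [/asboolP ab|/asboolP ba] := Atot _ _ Aa Ab.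
      + exists (sval b (x + y)); first by exists b.
        by rewrite (le_trans ((svalP b).1.1 x y))// lerD2r.
      + exists (sval a (x + y)); first by exists a.
        by rewrite (le_trans ((svalP a).1.1 x y))// lerD2l.
    - move=> t x _ t0 [a Aa <-]; exists (sval a (t *: x)); first by exists a.
      exact: (svalP a).1.2.
  have qle a x : A a -> inf (S x) <= sval a x.
    by move=> Aa; apply: ge_inf; [exact: (Sinf x).2 | exists a].
  have qs x : inf (S x) <= s x by rewrite (le_trans (qle _ x Aa0))// (svalP a0).2.
  by exists (exist below _ (conj qsub qs)) => a Aa; apply/asboolP => x /=; exact: qle.
- exists q; split => // q' q's q'q.
  have q'les x : q' x <= s x by exact: le_trans (q'q x) (qles x).
  have := qmin (exist below q' (conj q's q'les)).
  move=> /(_ _)/wrap[]; first exact/asboolP.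
  by move=> /(congr1 sval).
Qed.

(** A minimal sublinear functional [q] is linear.  For each [x] the functional
    [y |-> inf_(t >= 0) (q (y + t x) - t q x)] is sublinear and below [q], hence
    equal to [q]; the term [t = 1] then gives [q y + q x <= q (y + x)]. *)
Theorem hahn_banach s : sublinear s ->
  exists L : V -> R, [/\ forall x y, L (x + y) = L x + L y,
    forall a x, L (a *: x) = a * L x & forall x, L x <= s x].
Proof.
move=> /minimal_sublinear[q [qs qles qmin]].
have qZ t x : 0 <= t -> q (t *: x) = t * q x.
  rewrite le_eqVlt => /predU1P[<-|t0].
    by rewrite scale0r mul0r sublinear0.
  apply/eqP; rewrite eq_le qs.2//= mulrC -ler_pdivlMr//.
  rewrite -[X in q X <= _]scale1r -(mulVf (lt0r_neq0 t0)) -scalerA mulrC.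
  by rewrite qs.2// invr_gt0.
have qge x y : q y + q x <= q (y + x).
  pose S y := [set q (y + t *: x) - t * q x | t in [set t : R | 0 <= t]].
  have Sinf z : has_inf (S z).
    split; first by exists (q (z + 0 *: x) - 0 * q x), 0 => //=.
    exists (- q (- z)) => _ [t /= t0 <-]; rewrite -qZ//.
    have := qs.1 (z + t *: x) (- z); rewrite addrAC subrr add0r; lra.
  have Ssub : sublinear (fun z => inf (S z)).
    apply: inf_sublinear => //.
    - move=> u v _ _ [t /= t0 <-] [t' /= t'0 <-].
      exists (q (u + v + (t + t') *: x) - (t + t') * q x).
        by exists (t + t') => //=; exact: addr_ge0.
      have := qs.1 (u + t *: x) (v + t' *: x).
      by rewrite addrACA -scalerDl; lra.
    - move=> c u _ c0 [t /= t0 <-].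
      exists (q (c *: u + (c * t) *: x) - (c * t) * q x).
        by exists (c * t) => //=; rewrite mulr_ge0// ltW.
      by rewrite -scalerA -scalerDr qZ ?(ltW c0)// mulrBr mulrA lexx.
  have Sq z : inf (S z) <= q z.
    apply: ge_inf; first exact: (Sinf z).2.
    by exists 0 => //=; rewrite scale0r addr0 mul0r subr0.
  rewrite -lerBrDr -[X in X y <= _](qmin _ Ssub Sq).
  apply: ge_inf; first exact: (Sinf y).2.
  by exists 1 => //=; rewrite scale1r mul1r.
have qD x y : q (x + y) = q x + q y by apply/eqP; rewrite eq_le qs.1 qge.
exists q; split => // a x.
have [a0|a0] := leP 0 a; first exact: qZ.
have qN u : q (- u) = - q u.
  by apply/eqP; rewrite -subr_eq0 opprK -qD addNr sublinear0.
have := qZ (- a) x; rewrite scaleNr qN mulNr oppr_ge0.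
by move=> /(_ (ltW a0))/oppr_inj.
Qed.

End HahnBanach.

(** * From a positive functional on a compact Hausdorff space to an outer measure *)
Section RieszOuterMeasure.
Context {R : realType} {T : topologicalType}.
Implicit Types (f g h : T -> R) (U V A : set T).

Definition positive_functional (L : (T -> R) -> R) : Prop :=
  [/\ forall f g, continuous f -> continuous g -> L (f \+ g) = L f + L g,
      forall a f, continuous f -> L (fun x => a * f x) = a * L f,
      forall f, continuous f -> (forall x, 0 <= f x) -> 0 <= L f &
      L (fun=> 1) = 1].

(** A test function for the open set [U].  It only has to vanish outside [U];
    [subordinate_cutoff] recovers closed supports up to an arbitrarily small
    error. *)
Definition subordinate U f :=
  [/\ continuous f, forall x, 0 <= f x <= 1 & forall x, ~ U x -> f x = 0].

Variable L : (T -> R) -> R.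
Hypothesis Lpos : positive_functional L.

Let LD f g : continuous f -> continuous g -> L (f \+ g) = L f + L g.
Proof. by case: Lpos => + _ _ _; apply. Qed.

Let LZ a f : continuous f -> L (fun x => a * f x) = a * L f.
Proof. by case: Lpos => _ + _ _; apply. Qed.

Let L1 : L (fun=> 1) = 1. Proof. by case: Lpos. Qed.

Lemma positive_functional_le f g : continuous f -> continuous g ->
  (forall x, f x <= g x) -> L f <= L g.
Proof.
move=> cf cg fg; have cgf : continuous (fun x => g x - f x).
  by move=> x; apply: continuousB; [exact: cg | exact: cf].
have -> : g = f \+ (fun x => g x - f x) by apply/funext => x /=; rewrite addrC subrK.
rewrite LD// lerDl; case: Lpos => _ _ + _; apply => // x.
by rewrite subr_ge0.
Qed.

Let cst_cont (a : R) : continuous (fun _ : T => a).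
Proof. by move=> x; exact: cvg_cst. Qed.

Lemma positive_functional_cst a : L (fun=> a) = a.
Proof.
have -> : (fun _ : T => a) = (fun x => a * (fun=> 1) x).
  by apply/funext => x; rewrite mulr1.
by rewrite LZ ?L1 ?mulr1//; exact: cst_cont.
Qed.

Definition content U : R := sup [set L f | f in subordinate U].

Lemma subordinate0 U : subordinate U (fun=> 0).
Proof. by split=> [|x|//]; [exact: cst_cont | rewrite lexx ler01]. Qed.

Lemma subordinate_le1 U f : subordinate U f -> L f <= 1.
Proof.
move=> [cf f01 _]; rewrite -L1; apply: positive_functional_le => // x.
by have /andP[] := f01 x.
Qed.

Lemma content_has_sup U : has_sup [set L f | f in subordinate U].
Proof.
split; first by exists (L (fun=> 0)), (fun=> 0) => //; exact: subordinate0.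
by exists 1 => _ [f /subordinate_le1 + <-].
Qed.

Lemma content_ub U f : subordinate U f -> L f <= content U.
Proof. by move=> Uf; apply: ub_le_sup; [exact: (content_has_sup U).2 | exists f]. Qed.

Lemma content_le U r : (forall f, subordinate U f -> L f <= r) -> content U <= r.
Proof.
move=> h; apply: ge_sup; first exact: (content_has_sup U).1.
by move=> _ [f Uf <-]; exact: h.
Qed.

Lemma content_ge0 U : 0 <= content U.
Proof. by rewrite (le_trans _ (content_ub (subordinate0 U)))// positive_functional_cst. Qed.

Lemma content_le1 U : content U <= 1.
Proof. by apply: content_le => f; exact: subordinate_le1. Qed.

Lemma content_mono U V : U `<=` V -> content U <= content V.
Proof.
move=> UV; apply: content_le => f [cf f01 f0]; apply: content_ub.
by split=> // x nVx; apply: f0 => /UV.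
Qed.

Lemma content_set0 : content set0 = 0.
Proof.
apply/eqP; rewrite eq_le content_ge0 andbT; apply: content_le => f [_ _ f0].
have -> : f = fun=> 0 by apply/funext => x; exact: f0.
by rewrite positive_functional_cst.
Qed.

Lemma content_setT : content setT = 1.
Proof.
apply/eqP; rewrite eq_le content_le1/= -L1; apply: content_ub.
split=> [|x|x /= []//]; [exact: cst_cont | by rewrite ler01 lexx].
Qed.

(** The positive part of [f - e] differs from [f] by at most [e] and lives on the
    closed subset [[set x | e <= f x]] of [U]. *)
Lemma subordinate_cutoff U f e : 0 < e -> subordinate U f ->
  exists g, [/\ subordinate U g, L f <= L g + e,
    closed [set x | e <= f x], [set x | e <= f x] `<=` U &
    forall x, f x < e -> g x = 0].
Proof.
move=> e0 [cf f01 f0]; pose g x := Num.max (f x - e) 0.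
have cg : continuous g.
  move=> x; apply: (@continuous_max R T (fun x => f x - e) (fun=> 0)).
    by apply: continuousB; [exact: cf | exact: cvg_cst].
  exact: cvg_cst.
have gf x : g x <= f x.
  by rewrite ge_max; have /andP[-> _] := f01 x; rewrite lerBlDr lerDl ltW.
have ge0 x : f x < e -> g x = 0.
  by move=> fe; apply: max_idPr; rewrite subr_le0 ltW.
exists g; split => //.
- split => //.
    move=> x; rewrite (le_trans (gf x)) ?andbT; last by have /andP[] := f01 x.
    by rewrite le_max lexx orbT.
  by move=> x /f0 fx; apply: ge0; rewrite fx.
- rewrite -(positive_functional_cst e) -LD//.
  apply: positive_functional_le => //.
    by move=> x; apply: continuousD; [exact: cg | exact: cvg_cst].
  by move=> x /=; rewrite -lerBlDr le_max lexx.
- by have /continuous_closedP h := cf; apply: (h [set y | e <= y]); exact: closed_ge.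
- by move=> x /= ef; apply: contrapT => /f0 fx; move: ef; rewrite fx leNgt e0.
Qed.

Hypotheses (compactT : compact [set: T]) (hausT : hausdorff_space T).

(** The closed sets [K `\` U] and [K `\` V] are disjoint, so a Urysohn function
    splits a test function supported in [K] into one for [U] and one for [V]. *)
Lemma contentU U V : open U -> open V -> content (U `|` V) <= content U + content V.
Proof.
move=> oU oV; apply: content_le => f UVf; apply/ler_addgt0Pr => e e0.
have [g [[cg g01 _] fg clK KUV g0]] := subordinate_cutoff e0 UVf.
rewrite (le_trans fg)// lerD2r.
pose K := [set x | e <= f x].
have clU : closed (K `\` U) by apply: closedI => //; exact: open_closedC.
have clV : closed (K `\` V) by apply: closedI => //; exact: open_closedC.
have UV0 : (K `\` U) `&` (K `\` V) = set0.
  by rewrite -subset0 => x [[/KUV[Ux|Vx] nUx] [_ nVx]].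
have /(@normal_separatorP R)/(_ _ _ clU clV UV0) := compact_normal hausT compactT.
move=> /(@uniform_separatorP _ R)[u [cu u01 uU uV]].
have {}u01 x : 0 <= u x <= 1 by have := u01 (u x) (imageT _ _); rewrite /= in_itv.
have {}uU x : K x -> ~ U x -> u x = 0 by move=> Kx nUx; apply: uU; exists x.
have {}uV x : K x -> ~ V x -> u x = 1 by move=> Kx nVx; apply: uV; exists x.
have gK x : ~ K x -> g x = 0 by move=> /negP; rewrite -ltNge => /g0.
have cgu : continuous (fun x => g x * u x).
  by move=> x; apply: cvgM; [exact: cg | exact: cu].
have c1u : continuous (fun x => 1 - u x).
  by move=> x; apply: continuousB; [exact: cvg_cst | exact: cu].
have cgu' : continuous (fun x => g x * (1 - u x)).
  by move=> x; apply: cvgM; [exact: cg | exact: c1u].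
have -> : g = (fun x => g x * u x) \+ (fun x => g x * (1 - u x)).
  by apply/funext => x /=; rewrite -mulrDr addrC subrK mulr1.
rewrite LD//; apply: lerD; apply: content_ub; split => //.
- move=> x; have /andP[gx0 gx1] := g01 x; have /andP[ux0 ux1] := u01 x.
  by rewrite mulr_ge0//= mulr_ile1.
- move=> x nUx; have [/uU ->//|/gK ->] := pselect (K x); by rewrite ?mulr0 ?mul0r.
- move=> x; have /andP[gx0 gx1] := g01 x; have /andP[ux0 ux1] := u01 x.
  by rewrite mulr_ge0 ?subr_ge0//= mulr_ile1 ?subr_ge0// lerBlDr lerDl.
- move=> x nVx; have [/uV ->//|/gK ->] := pselect (K x);
    by rewrite ?subrr ?mulr0 ?mul0r.
Qed.

(** Compactness of the support reduces a countable union to a finite one. *)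
Lemma content_bigcup (U : nat -> set T) s : (forall i, open (U i)) ->
  (forall n, \sum_(i < n) content (U i) <= s) -> content (\bigcup_i U i) <= s.
Proof.
move=> oU Us; apply: content_le => f Uf; apply/ler_addgt0Pr => e e0.
have [g [[cg g01 _] fg clK KU g0]] := subordinate_cutoff e0 Uf.
rewrite (le_trans fg)// lerD2r.
have /= : compact [set x | e <= f x] by apply: subclosed_compact compactT _.
move=> /compact_near_coveringP ncK.
pose W k := \big[setU/set0]_(i < k) U i.
have oW k : open (W k).
  by rewrite /W; elim/big_ind : _ => //; [exact: open0 | exact: openU].
have cW k : content (W k) <= \sum_(i < k) content (U i).
  elim: k => [|k ih]; first by rewrite /W !big_ord0 content_set0.
  rewrite /W !big_ord_recr/= (le_trans (contentU (oW k) (oU k)))//.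
  by rewrite lerD2r.
have [|N _ /(_ N (leqnn N)) KN] := ncK nat \oo (fun n x => W n x) _.
  move=> x /KU[i _ Uix]; exists (U i, [set n | (i < n)%N]).
    split; first by apply: open_nbhs_nbhs; split; [exact: oU|].
    by exists i.+1.
  move=> [y n] [/= Uiy ni]; rewrite /W -bigcup_mkord.
  by exists i.
apply: le_trans (Us N); apply: le_trans (cW N); apply: content_ub.
split => // x nWx; apply: g0; rewrite ltNge; apply/negP => /KN.
exact: nWx.
Qed.

Definition riesz_outer A : \bar R :=
  (inf [set content U | U in [set U | open U /\ A `<=` U]])%:E.

Lemma riesz_outer_has_inf A :
  has_inf [set content U | U in [set U | open U /\ A `<=` U]].
Proof.
split; first by exists (content setT), setT => //; split => //; exact: openT.
by exists 0 => _ [U _ <-]; exact: content_ge0.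
Qed.

Lemma riesz_outer_le A U : open U -> A `<=` U -> (riesz_outer A <= (content U)%:E)%E.
Proof.
move=> oU AU; rewrite lee_fin; apply: ge_inf; first exact: (riesz_outer_has_inf A).2.
by exists U.
Qed.

Lemma riesz_outer_approx A e : 0 < e ->
  exists U, [/\ open U, A `<=` U & ((content U)%:E <= riesz_outer A + e%:E)%E].
Proof.
move=> e0; have [_ [U [oU AU] <-] cU] := inf_adherent e0 (riesz_outer_has_inf A).
by exists U; split => //; rewrite -EFinD lee_fin ltW.
Qed.

Lemma riesz_outer_open U : open U -> riesz_outer U = (content U)%:E.
Proof.
move=> oU; apply/eqP; rewrite eq_le riesz_outer_le//=.
rewrite lee_fin; apply: lb_le_inf; first exact: (riesz_outer_has_inf U).1.
by move=> _ [V [_ UV] <-]; exact: content_mono.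
Qed.

Lemma riesz_outer0 : riesz_outer set0 = 0%E.
Proof. by rewrite riesz_outer_open ?content_set0//; exact: open0. Qed.

Lemma riesz_outer_ge0 A : (0 <= riesz_outer A)%E.
Proof.
rewrite lee_fin; apply: lb_le_inf; first exact: (riesz_outer_has_inf A).1.
by move=> _ [U _ <-]; exact: content_ge0.
Qed.

Lemma riesz_outer_mono : {homo riesz_outer : A B / A `<=` B >-> (A <= B)%E}.
Proof.
move=> A B AB; apply/lee_addgt0Pr => e e0.
have [U [oU BU]] := riesz_outer_approx B e0; apply: le_trans.
by apply: riesz_outer_le => //; exact: subset_trans BU.
Qed.

Lemma riesz_outer_sigma_subadditive : sigma_subadditive riesz_outer.
Proof.
move=> F; apply/lee_addgt0Pr => e e0.
apply: le_trans (epsilon_trick xpredT (fun i => riesz_outer_ge0 (F i)) (ltW e0)).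
set S := (X in (_ <= X)%E).
have ei n : 0 < e / (2 ^ n.+1)%:R by rewrite divr_gt0// ltr0n expn_gt0.
have /choice[U Uh] i := riesz_outer_approx (F i) (ei i).
have Spart n : (\sum_(i < n) (content (U i))%:E <= S)%E.
  rewrite -(big_mkord xpredT (fun i => (content (U i))%:E)).
  apply: le_trans (nneseries_lim_ge _ _) => [|i _ _]; last first.
    by rewrite adde_ge0 ?riesz_outer_ge0// lee_fin ltW.
  by apply: lee_sum => i _; have [] := Uh i.
have [->|Sfin] := eqVneq S +oo%E; first exact: leey.
have S0 : (0 <= S)%E by have := Spart 0%N; rewrite big_ord0.
have Sf : S \is a fin_num by rewrite ge0_fin_numE// lt_neqAle Sfin leey.
rewrite -(fineK Sf); apply: (@le_trans _ _ (content (\bigcup_i U i))%:E).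
  apply: riesz_outer_le; first by apply: bigcup_open => i _; have [] := Uh i.
  by apply: subset_bigcup => i _; have [] := Uh i.
rewrite lee_fin; apply: content_bigcup => [i|n]; first by have [] := Uh i.
by rewrite -lee_fin fineK// -sumEFin.
Qed.

(** Reduce to an open test set [V].  Take [f] nearly optimal for [V `&` U], cut
    it off to a closed support [K] inside [U]; then [V `\` K] is an open set
    containing [V `\` U], and test functions for it can be added to the cut-off
    of [f] without exceeding 1 or leaving [V]. *)
Lemma riesz_outer_caratheodory U : open U -> caratheodory_measurable riesz_outer U.
Proof.
move=> oU.
pose m : {outer_measure set T -> \bar R} := HB.pack riesz_outer
  (isOuterMeasure.Build R T riesz_outer riesz_outer0 riesz_outer_ge0
     riesz_outer_mono riesz_outer_sigma_subadditive).
apply: (@le_caratheodory_measurable R T m) => A /=.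
apply/lee_addgt0Pr => e e0.
have e3 : 0 < e / 3 by rewrite divr_gt0.
have [V [oV AV cV]] := riesz_outer_approx A e3.
suff h : ((riesz_outer (V `&` U) + riesz_outer (V `&` ~` U) <=
    (content V + (e / 3 + e / 3))%:E)%E).
  apply: (@le_trans _ _ (riesz_outer (V `&` U) + riesz_outer (V `&` ~` U))%E).
    by apply: leeD; apply: riesz_outer_mono; exact: setSI.
  apply: le_trans h _; rewrite EFinD (le_trans (leeD2r _ cV))//.
  by rewrite -addeA leeD2l// -EFinD lee_fin; lra.
have [_ [f VUf <-]] := sup_adherent e3 (content_has_sup (V `&` U)).
rewrite -/(content _) ltrBlDr => cf.
have [f' [VUf' ff' clK KVU f'0]] := subordinate_cutoff e3 VUf.
pose K := [set x | e / 3 <= f x].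
have oVK : open (V `\` K) by apply: openI => //; exact: closed_openC.
have cVK : content (V `\` K) <= content V - L f'.
  apply: content_le => g [cg g01 g0]; rewrite lerBrDl.
  have [cf' f'01 f'V] := VUf'.
  rewrite -LD//; apply: content_ub; split => [x|x|x nVx] /=.
  - by apply: cvgD; [exact: cf' | exact: cg].
  - have [Kx|/negP] := pselect (K x).
      by rewrite (g0 x) ?addr0// => -[].
    by rewrite -ltNge => /f'0 ->; rewrite add0r.
  - by rewrite f'V ?add0r => [|[]//]; rewrite g0// => -[].
rewrite riesz_outer_open; last exact: openI.
have h2 : (riesz_outer (V `&` ~` U) <= (content (V `\` K))%:E)%E.
  by apply: riesz_outer_le => // x [Vx nUx]; split => // /KVU[].
apply: le_trans (leeD2l _ h2) _; rewrite -EFinD lee_fin; lra.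
Qed.

(** The last clause is the half of the Riesz representation theorem that the
    layer-cake argument of [riesz_dual_ball] needs. *)
Lemma riesz_outer_measure : exists m : {outer_measure set T -> \bar R},
  [/\ forall U, open U -> caratheodory_measurable m U,
      m setT = 1%E,
      forall A, m A = ereal_inf [set m U | U in [set U | open U /\ A `<=` U]] &
      forall U f, open U -> subordinate U f -> ((L f)%:E <= m U)%E].
Proof.
pose m : {outer_measure set T -> \bar R} := HB.pack riesz_outer
  (isOuterMeasure.Build R T riesz_outer riesz_outer0 riesz_outer_ge0
     riesz_outer_mono riesz_outer_sigma_subadditive).
exists m; split => /=.
- exact: riesz_outer_caratheodory.
- by rewrite riesz_outer_open ?content_setT//; exact: openT.
- move=> A; apply/eqP; rewrite eq_le; apply/andP; split.
    by apply: le_ereal_inf_tmp => _ [U [oU AU] <-]; exact: riesz_outer_mono.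
  apply/lee_addgt0Pr => e e0; have [U [oU AU cU]] := riesz_outer_approx A e0.
  by apply: le_trans cU; apply: ereal_inf_lbound; exists U => //; exact: riesz_outer_open.
- by move=> U f oU Uf; rewrite riesz_outer_open// lee_fin content_ub.
Qed.

End RieszOuterMeasure.

(** * Multilinear maps and polarization *)
Section Polarization.
Context {K : numFieldType} {n : nat} {X Y : lmodType K}.
Implicit Types (A : ('I_n -> X) -> Y) (P : X -> Y) (x : 'I_n -> X).

Lemma dfwith_id x i : dfwith x i (x i) = x.
Proof. by apply/funext => j; case: dfwithP. Qed.

Lemma multilinear_eq0 A x i : multilinear A -> x i = 0 -> A x = 0.
Proof.
move=> mA xi; have := mA i x (-1) 0 0.
by rewrite scaler0 addr0 scaleN1r addNr -xi dfwith_id.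
Qed.

Lemma multilinear_scale A x (c : K) : multilinear A ->
  A (fun i => c *: x i) = c ^+ n *: A x.
Proof.
move=> mA; pose z (j : nat) (i : 'I_n) := if (i < j)%N then c *: x i else x i.
have -> : (fun i => c *: x i) = z n by apply/funext => i; rewrite /z ltn_ord.
have zj (j : nat) : (j <= n)%N -> A (z j) = c ^+ j *: A x.
  elim: j => [_|j ih jn]; first by rewrite expr0 scale1r.
  pose i0 := Ordinal jn.
  have zE : z j.+1 = dfwith (z j) i0 (c *: x i0 + 0).
    apply/funext => i; rewrite addr0; have [<-|i0i] := eqVneq i0 i.
      by rewrite dfwithin /z /= ltnSn.
    rewrite dfwithout// /z ltnS leq_eqVlt.
    by have /negPf -> : (i : nat) != j by apply: contra i0i => /eqP ij; exact/eqP/val_inj.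
  have z0 : A (dfwith (z j) i0 0) = 0.
    by apply: (@multilinear_eq0 _ _ i0) => //; rewrite dfwithin.
  have zi0 : dfwith (z j) i0 (x i0) = z j.
    by rewrite -[RHS](dfwith_id _ i0) /z /= ltnn.
  by rewrite zE mA z0 addr0 zi0 ih ?(ltnW jn)// scalerA exprS.
exact: zj.
Qed.

Lemma multilinear_sum A (J : finType) x i (u : J -> X) : multilinear A ->
  A (dfwith x i (\sum_j u j)) = \sum_j A (dfwith x i (u j)).
Proof.
move=> mA; pose F : {linear X -> Y} := HB.pack (fun u => A (dfwith x i u))
  (GRing.isLinear.Build _ _ _ _ _ (mA i x)).
exact: (raddf_sum F).
Qed.

(** Induction on the list [l] of coordinates already expanded.  The choice
    functions are pinned to [j0] off [l], so that each term is counted once. *)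
Lemma multilinear_expand A (J : finType) (y : 'I_n -> J -> X) : multilinear A ->
  A (fun i => \sum_j y i j) = \sum_(f : {ffun 'I_n -> J}) A (fun i => y i (f i)).
Proof.
move=> mA; have [j0 _|J0] := pickP (fun _ : J => true); last first.
  have [i0 _|I0] := pickP (fun _ : 'I_n => true).
    rewrite (@multilinear_eq0 _ _ i0)//; last by rewrite big_pred0.
    by rewrite big_pred0// => f; have := J0 (f i0).
  have In0 (i : 'I_n) : False by have := I0 i.
  rewrite (big_pred1 (finfun (fun i => False_rect J (In0 i)))) => [|f].
    by congr A; apply/funext => i; case: (In0 i).
  by apply/esym/eqP/ffunP => i; case: (In0 i).
pose fixed (l : seq 'I_n) (f : {ffun 'I_n -> J}) :=
  [forall i, (i \notin l) ==> (f i == j0)].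
suff h (l : seq 'I_n) (b : 'I_n -> X) : uniq l ->
    A (fun i => if i \in l then \sum_j y i j else b i) =
    \sum_(f | fixed l f) A (fun i => if i \in l then y i (f i) else b i).
  have := h (enum 'I_n) (fun=> 0) (enum_uniq _).
  under eq_fun do rewrite mem_enum.
  move=> ->; apply: eq_big => [f|f _].
    by apply/forallP => i; rewrite mem_enum.
  by congr A; apply/funext => i; rewrite mem_enum.
elim: l b => [|i0 l ih] b /=.
  move=> _; rewrite (big_pred1 [ffun=> j0])// => f.
  apply/forallP/eqP => [fj|-> i]; last by rewrite ffunE eqxx implybT.
  by apply/ffunP => i; rewrite ffunE; apply/eqP; have := fj i.
move=> /andP[i0l ul].
pose upd (j : J) (f : {ffun 'I_n -> J}) := [ffun i => if i == i0 then j else f i].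
(* Sort the choice functions by their value at the new coordinate i0. *)
rewrite (partition_big (fun f : {ffun _} => f i0) predT)//=.
pose x i := if i \in l then \sum_j y i j else b i.
have -> : (fun i => if i \in i0 :: l then \sum_j y i j else b i) =
    dfwith x i0 (\sum_j y i0 j).
  apply/funext => i; rewrite in_cons; case: dfwithP => [|i' /negPf].
    by rewrite eqxx.
  by rewrite eq_sym => ->.
rewrite multilinear_sum//; apply: eq_bigr => j _.
have -> : dfwith x i0 (y i0 j) =
    fun i => if i \in l then \sum_j y i j else dfwith b i0 (y i0 j) i.
  apply/funext => i; case: dfwithP => [|i' ii']; first by rewrite (negPf i0l) dfwithin.
  by rewrite /x dfwithout.
rewrite ih// [RHS](reindex_onto (upd j) (upd j0)) /=; last first.
  move=> f /andP[_ /eqP fj]; apply/ffunP => i; rewrite !ffunE.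
  by case: eqP => // ->.
apply: eq_big => [f|f ff].
  apply/forallP/andP => [fj|[/andP[/forallP fj _] /eqP ffj] i].
    split.
      rewrite /upd ffunE eqxx eqxx andbT; apply/forallP => i; rewrite in_cons ffunE.
      by case: eqP => //= _; exact: fj.
    apply/eqP/ffunP => i; rewrite !ffunE; case: eqP => // ->.
    by have := fj i0; rewrite i0l => /eqP.
  apply/implyP => il; have [->|ii0] := eqVneq i i0.
    by rewrite -ffj ffunE eqxx.
  by have := fj i; rewrite in_cons negb_or ii0 il/= ffunE (negPf ii0).
congr A; apply/funext => i; rewrite in_cons ffunE.
have [->|ii0] /= := eqVneq i i0; first by rewrite (negPf i0l) dfwithin.
by rewrite dfwithout// eq_sym.
Qed.

(** The [n]-th difference of [P] at 0 in the directions [x]: the sum over all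
    subsets [s] of the indices, with sign [(-1) ^ #|~: s|]. *)
Definition polar P x : Y :=
  \sum_(s : {ffun 'I_n -> bool})
    (\prod_i (if s i then 1 else -1)) *: P (\sum_j (s j)%:R *: x j).

(** Expand every [A (sum, ..., sum)] by multilinearity.  If the choice function [f]
    misses an index [j0], toggling the membership of [j0] in [s] flips the sign and
    nothing else, so the terms cancel; if [f] is a bijection, only the full set
    [s] contributes. *)
Lemma polar_multilinear A x : multilinear A ->
  polar (fun u => A (fun=> u)) x = \sum_(f : {ffun 'I_n -> 'I_n} | injectiveb f) A (x \o f).
Proof.
move=> mA; rewrite /polar.
under eq_bigr do rewrite multilinear_expand// scaler_sumr.
rewrite exchange_big/= (bigID (fun f : {ffun 'I_n -> 'I_n} => injectiveb f))/=.
rewrite [X in _ + X]big1 ?addr0; last first.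
  move=> f /injectiveP fNinj.
  have [j0 j0f] : exists j0, forall i, f i != j0.
    apply: contrapT => /forallNP nf; apply: fNinj.
    have fsurj j : j \in [seq f i | i in 'I_n].
      apply/fintype.imageP; apply: contrapT => nfj; apply: (nf j) => i.
      by apply/eqP => fij; apply: nfj; exists i.
    have /image_injP finj : #|[seq f i | i in 'I_n]| == #|'I_n|.
      by apply/eqP/eq_card => j; rewrite fsurj.
    by move=> i j; exact: finj.
  pose tog (s : {ffun 'I_n -> bool}) := [ffun i => if i == j0 then ~~ s i else s i].
  have togK : involutive tog.
    by move=> s; apply/ffunP => i; rewrite !ffunE; case: eqP => // _; rewrite negbK.
  set S := LHS.
  have : S = - S.
    rewrite {1}/S (reindex_inj (inv_inj togK)) -sumrN; apply: eq_bigr => s _.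
    rewrite -scaleNr; congr (_ *: A _).
      rewrite (bigD1 j0)//= [in RHS](bigD1 j0)//= ffunE eqxx.
      rewrite (eq_bigr (fun i => if s i then 1 else -1)); last first.
        by move=> i /negPf ij0; rewrite ffunE ij0.
      by case: (s j0); rewrite /= ?mulN1r ?mul1r ?opprK.
    by apply/funext => i; rewrite ffunE (negPf (j0f i)).
  move/eqP; rewrite -addr_eq0 -mulr2n -scaler_nat scaler_eq0 pnatr_eq0/=.
  by move/eqP.
apply: eq_bigr => f /injectiveP finj.
rewrite (bigD1 [ffun=> true])//= big1 => [|i _]; last by rewrite ffunE.
rewrite scale1r [X in _ + X]big1 ?addr0.
  by congr A; apply/funext => i; rewrite ffunE scale1r.
move=> s s1; have [j sj] : exists j, ~~ s j.
  apply/existsP; apply: contraNT s1; rewrite negb_exists => /forallP h.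
  by apply/eqP/ffunP => i; rewrite ffunE; have := h i; rewrite negbK.
rewrite (@multilinear_eq0 _ _ (invF finj j))// ?scaler0//.
by rewrite f_invF (negPf sj) scale0r.
Qed.

(** The reason for polarizing: a bound on [P] passes to [polar P], whereas the
    multilinear map [A] that defines [P] need not be bounded. *)
Lemma multilinear_polar A : multilinear A -> multilinear (polar (fun u => A (fun=> u))).
Proof.
move=> mA i x a u v; rewrite !polar_multilinear// scaler_sumr -big_split/=.
apply: eq_bigr => f /injectiveP finj.
have e w : dfwith x i w \o f = dfwith (x \o f) (invF finj i) w.
  apply/funext => k /=; have [<-|kfi] := eqVneq (invF finj i) k.
    by rewrite f_invF !dfwithin.
  by rewrite !dfwithout//; apply: contra kfi => /eqP ->; rewrite invF_f.
by rewrite !e mA.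
Qed.

Definition polar_count : K := #|[pred f : {ffun 'I_n -> 'I_n} | injectiveb f]|%:R.

Lemma polar_count_neq0 : polar_count != 0.
Proof.
rewrite pnatr_eq0 -lt0n; apply/card_gt0P; exists [ffun i => i].
by rewrite inE; apply/injectiveP => i j; rewrite !ffunE.
Qed.

Lemma polar_diag A u : multilinear A ->
  polar (fun u => A (fun=> u)) (fun=> u) = polar_count *: A (fun=> u).
Proof.
move=> mA; rewrite polar_multilinear//= scaler_nat -sumr_const.
by apply: eq_bigl => f; rewrite inE.
Qed.

End Polarization.

(** * The topology of the scalar field *)
Section ScalarTopology.
Context {R : realType} {k : scalar_field}.
Local Notation K := (scalars R k).

Lemma rnorm_of_real (r : R) : rnorm (of_real r : K) = `|r|.
Proof.
rewrite /rnorm; have [r0|r0] := leP 0 r.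
  by rewrite !ger0_norm ?of_realK// -(@of_real0 R k) of_real_le.
have N : (of_real r : K) = - of_real (- r).
  by apply/eqP; rewrite -subr_eq0 opprK -of_realD subrr of_real0.
rewrite N normrN ger0_norm ?of_realK ?ltr0_norm//.
by rewrite -(@of_real0 R k) of_real_le oppr_ge0 ltW.
Qed.

(** The norms are scalar-valued, and the scalars may be complex; convergence can
    be tested with real [e]. *)
Lemma rcvgP {X : normedModType K} (I : Type) (F : set_system I) {FF : Filter F}
    (u : I -> X) (l : X) :
  (u @ F --> l) <-> (forall e : R, 0 < e -> \forall i \near F, rnorm (l - u i) < e).
Proof.
split=> [/cvgrPdist_lt ul e e0|ul].
  have := ul (of_real e); rewrite of_real_gt0 => /(_ e0).
  by apply: filterS => i; rewrite -rnormE of_real_lt.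
apply/cvgrPdist_lt => e e0; have := ul (sRe e).
rewrite -(@of_real_lt R k) of_real0 of_real_sRe ?ltW// => /(_ e0).
by apply: filterS => i; rewrite -(@of_real_lt R k) of_real_sRe ?ltW// rnormE.
Qed.

(** The imaginary unit, replaced by 0 over the reals so that [scalar_decomp] covers
    both scalar fields. *)
Definition sI : K := match k return scalars R k with
  | RealScalars => 0 | ComplexScalars => Complex 0 1 end.

Lemma scalar_decomp (z : K) : z = of_real (sRe z) + of_real (sIm z) * sI.
Proof.
rewrite /sRe /sIm /of_real /sI; case: k z => /= [z|[a b]]; first by rewrite mulr0 addr0.
by simpc.
Qed.

Lemma sRe_le (z : K) : `|sRe z| <= rnorm z.
Proof.
rewrite /rnorm /sRe; case: k z => //= -[a b].
by have := normc_ge_Re (Complex a b); rewrite lecE => /andP[_].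
Qed.

Lemma sIm_le (z : K) : `|sIm z| <= rnorm z.
Proof.
rewrite /sIm; case: k z => [z|[a b]]; first by rewrite normr0 rnorm_ge0.
have -> : rnorm (Complex a b : scalars R ComplexScalars) = Num.sqrt (a ^+ 2 + b ^+ 2).
  exact: (f_equal (@complex.Re R) (normc_def (Complex a b))).
by rewrite -sqrtr_sqr ler_wsqrtr//= lerDr sqr_ge0.
Qed.

Lemma rnorm_continuous (X : normedModType K) : continuous (fun x : X => rnorm x).
Proof.
move=> x; apply/(@cvgrPdist_lt _ _ _ (nbhs x)) => e e0.
have /rcvgP/(_ e e0) : (fun y : X => y) @ x --> x by exact: cvg_id.
apply: filterS => y; apply: le_lt_trans.
rewrite ler_norml lerBlDr lerBrDl; apply/andP; split.
  by rewrite lerBlDl -[y in leLHS](subrK x) (le_trans (rnormD _ _))// -opprB rnormN addrC.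
by rewrite -[x in leLHS](subrK y) (le_trans (rnormD _ _)).
Qed.

(** The ball is a closed subset of the continuous image of a square. *)
Lemma scalar_ball_compact (r : R) : compact [set z : K | rnorm z <= r].
Proof.
pose g (ab : R * R) : K := of_real ab.1 + of_real ab.2 * sI.
have cg : continuous g.
  move=> ab; apply/rcvgP => e e0.
  pose C := rnorm sI + 1; have C0 : 0 < C by rewrite ltr_wpDl// rnorm_ge0.
  have h (f : R * R -> R) : continuous f -> forall d, 0 < d -> 
      \forall x \near ab, `|f ab - f x| < d.
    by move=> cf d d0; have /cvgrPdist_lt := cf ab; exact.
  have e2C : 0 < e / 2 / C by rewrite !divr_gt0.
  near=> x.
  have -> : g ab - g x = of_real (ab.1 - x.1) + of_real (ab.2 - x.2) * sI.
    rewrite /g opprD addrACA -mulrBl; congr (_ + _ * _).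
      by apply/eqP; rewrite subr_eq -of_realD subrK.
    by apply/eqP; rewrite subr_eq -of_realD subrK.
  rewrite (le_lt_trans (rnormD _ _))// rnormM !rnorm_of_real [ltRHS]splitr ltr_leD//.
    near: x; apply: (h fst); last by rewrite divr_gt0.
    by move=> x; exact: cvg_fst.
  apply: (@le_trans _ _ (`|ab.2 - x.2| * C)).
    by rewrite ler_wpM2l// lerDl.
  rewrite -ler_pdivlMr// ltW//; near: x; apply: (h snd) => //.
  by move=> x; exact: cvg_snd.
have cK : compact (g @` (`[- r, r]%classic `*` `[- r, r]%classic)).
  apply: continuous_compact; first by apply: continuous_subspaceT.
  by apply: compact_setX; exact: segment_compact.
apply: subclosed_compact cK _.
  have /continuous_closedP h := @rnorm_continuous K.
  by apply: (h [set y | y <= r]); exact: closed_le.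
move=> z /= zr; exists (sRe z, sIm z); last by rewrite /g/= -scalar_decomp.
by split; rewrite /= in_itv/= -ler_norml (le_trans _ zr) ?sRe_le ?sIm_le.
Unshelve. all: by end_near. Qed.

Lemma scalar_hausdorff : hausdorff_space K.
Proof. exact: norm_hausdorff. Qed.

End ScalarTopology.

(** * The dual ball: compactness and separation *)
Section BoundedLinear.
Context {R : realType} {k : scalar_field} {X Y : normedModType (scalars R k)}.
Implicit Types f : X -> Y.

Lemma bounded_linear_continuous f C : linear f ->
  (forall x, rnorm (f x) <= C * rnorm x) -> continuous f.
Proof.
move=> lf fC x; apply/rcvgP => e e0.
pose F : {linear X -> Y} := HB.pack f (GRing.isLinear.Build _ _ _ _ f lf).
have C0 : 0 < `|C| + 1 by rewrite ltr_wpDl.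
have /rcvgP/(_ (e / (`|C| + 1))) : (fun y : X => y) @ x --> x by exact: cvg_id.
rewrite divr_gt0// => /(_ isT); apply: filterS => y xy.
rewrite -[f]/(F : X -> Y) -linearB/= (le_lt_trans (fC _))//.
apply: (@le_lt_trans _ _ ((`|C| + 1) * rnorm (x - y))).
  by rewrite ler_wpM2r ?rnorm_ge0// (le_trans (ler_norm _))// lerDl.
by rewrite mulrC -ltr_pdivlMr.
Qed.

Lemma opnorm_le f C : (forall x, rnorm x <= 1 -> rnorm (f x) <= C) -> opnorm f <= C.
Proof.
move=> fC; apply: ge_sup; first by exists (rnorm (f 0)), 0 => //=; rewrite rnorm0.
by move=> _ [x /= x1 <-]; exact: fC.
Qed.

Lemma opnorm_ge0 f : linear f -> continuous f -> 0 <= opnorm f.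
Proof.
move=> lf cf; have [_ /ub_le_sup h] := opnorm_has_sup lf cf.
by rewrite (le_trans _ (h (rnorm (f 0)) _)) ?rnorm_ge0//; exists 0 => //=; rewrite rnorm0.
Qed.

End BoundedLinear.

Section DualBallTopology.
Context {R : realType} {k : scalar_field} (E : normedModType (scalars R k)).
Local Notation K := (scalars R k).

(** This description involves no continuity and no supremum, only conditions that
    are closed for pointwise convergence. *)
Lemma dual_ball_setP (f : E -> K) : dual_ball_set f <->
  linear f /\ forall x, rnorm (f x) <= rnorm x.
Proof.
split=> [[[lf cf] f1]|[lf f1]].
  split => // x; rewrite (le_trans (rnorm_le_opnorm x lf cf))//.
  by rewrite ler_piMl// rnorm_ge0.
split; last by apply: opnorm_le => x; exact: le_trans.
by split => //; apply: (bounded_linear_continuous (C := 1)) => // x; rewrite mul1r.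
Qed.

Lemma dual_ballP (phi : dual_ball E) :
  linear (fun x : E => eval_at x phi) /\ forall x, rnorm (eval_at x phi) <= rnorm x.
Proof. exact/dual_ball_setP/set_mem/(valP phi). Qed.

Lemma eval_atP a x y (phi : dual_ball E) :
  eval_at (a *: x + y) phi = a * eval_at x phi + eval_at y phi.
Proof. exact: (dual_ballP phi).1. Qed.

Lemma eval_at0 (phi : dual_ball E) : eval_at 0 phi = 0.
Proof.
have := eval_atP (-1) 0 0 phi.
by rewrite scaler0 addr0 mulN1r addNr.
Qed.

Lemma eval_atZ a x (phi : dual_ball E) : eval_at (a *: x) phi = a * eval_at x phi.
Proof. by rewrite -[_ *: _]addr0 eval_atP eval_at0 addr0. Qed.

Definition to_dual_ball (f : E -> K) (h : dual_ball_set f) : dual_ball E :=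
  exist _ f (mem_set h).

Lemma eval_at_to_dual_ball f (h : dual_ball_set f) x : eval_at x (to_dual_ball h) = f x.
Proof. by []. Qed.

(** The Banach-Alaoglu theorem: a closed subset of a product of compact balls. *)
Lemma dual_ball_set_compact : compact (@dual_ball_set R k E).
Proof.
have cb : compact [set f : {ptws E -> K} | forall x, [set z | rnorm z <= rnorm x] (f x)].
  apply: (@tychonoff E (fun=> K) (fun x => [set z : K | rnorm z <= rnorm x])) => x.
  exact: scalar_ball_compact.
apply: subclosed_compact cb _; last first.
  by move=> f /dual_ball_setP[_ fx] x; exact: fx.
have -> : @dual_ball_set R k E =
    (\bigcap_(t in [set: K * E * E])
      [set f : {ptws E -> K} | rnorm (f (t.1.1 *: t.1.2 + t.2) -
         (t.1.1 * f t.1.2 + f t.2)) <= 0]) `&`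
    (\bigcap_(x in [set: E]) [set f : {ptws E -> K} | rnorm (f x) <= rnorm x]).
  apply/seteqP; split => f.
    move=> /dual_ball_setP[lf fx]; split => [[[a x] y] _|x _] /=; last exact: fx.
    by rewrite lf subrr rnorm0.
  move=> [lf fx]; apply/dual_ball_setP; split=> [a x y|x]; last exact: fx.
  apply/eqP; rewrite -subr_eq0; apply/eqP/rnorm_eq0/eqP.
  by rewrite eq_le rnorm_ge0 andbT; exact: (lf (a, x, y) I).
have pc (x : E) : continuous (fun f : {ptws E -> K} => f x).
  exact: (@proj_continuous _ (fun=> K) x).
have cl (g : {ptws E -> K} -> K) r : continuous g -> closed [set f | rnorm (g f) <= r].
  move=> cg; have /continuous_closedP h : continuous (fun f => rnorm (g f)).
    by move=> f; apply: continuous_comp (cg f) _; exact: rnorm_continuous.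
  by apply: (h [set y | y <= r]); exact: closed_le.
apply: closedI; apply: closed_bigI.
  move=> [[a x] y] _; apply: (cl (fun f => f (a *: x + y) - (a * f x + f y))).
  move=> f; have pcf := pc ^~ f.
  pose u0 : {ptws E -> K} -> K := fun g => g (a *: x + y).
  pose u1 : {ptws E -> K} -> K := fun g => g x.
  pose u2 : {ptws E -> K} -> K := fun g => g y.
  have c0 : u0 @ f --> u0 f by exact: pc.
  have c1 : u1 @ f --> u1 f by exact: pc.
  have c2 : u2 @ f --> u2 f by exact: pc.
  have c3 : (fun g => a * u1 g) @ f --> a * u1 f by exact: cvgMr c1.
  have /(_ (nbhs_filter _)) c4 := cvgD c3 c2.
  by have /(_ (nbhs_filter _)) := cvgB c0 c4.
by move=> x _; apply: cl; exact: pc.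
Qed.

Lemma dual_ball_compact : compact [set: dual_ball E].
Proof.
move=> F FF _.
pose G := (set_val : dual_ball E -> {ptws E -> K}) @ F.
have PG : ProperFilter G by exact: fmap_proper_filter.
have GD : G (@dual_ball_set R k E).
  by apply: (@filterS _ F _ setT) => [phi _|]; [exact: set_mem (valP phi) | exact: filterT].
have [] := dual_ball_set_compact PG GD.
move=> f [Df cf]; exists (to_dual_ball Df); split => // A B FA.
move=> [_ [[V oV <-] Vf] VB].
have GA : G (set_val @` A).
  by apply: (@filterS _ F _ A) => // phi Aphi; exists phi.
have [_ [[phi Aphi <-] Vphi]] := cf _ _ GA (open_nbhs_nbhs (conj oV Vf)).
by exists phi; split => //; exact: VB.
Qed.

Lemma dual_ball_hausdorff : hausdorff_space (dual_ball E).
Proof.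
rewrite open_hausdorff => phi psi phipsi.
have [x xne] : exists x, eval_at x phi != eval_at x psi.
  apply: contrapT => /forallNP h; move/eqP: phipsi; apply; apply: val_inj.
  by apply/funext => x; apply/eqP; apply: contrapT => /negP; exact: h.
have := @scalar_hausdorff R k; rewrite open_hausdorff.
move=> /(_ _ _ xne)[[A B] /= [pA pB] [oA oB AB]].
have /continuousP ce := @eval_at_continuous R k E x.
exists (eval_at x @^-1` A, eval_at x @^-1` B); first by rewrite !inE in pA pB *.
split; [exact: ce | exact: ce |].
by rewrite -preimage_setI (eqP AB) preimage_set0.
Qed.

End DualBallTopology.

(** * Uniform boundedness of weakly summable sequences *)
Section WeakSummability.
Context {R : realType} {k : scalar_field} {E : normedModType (scalars R k)}.
Local Notation K := (scalars R k).

(** A crude substitute for the Minkowski inequality: the larger summand dominates. *)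
Lemma powR_add_le (p a b : R) : 0 <= p -> 0 <= a -> 0 <= b ->
  (a + b) `^ p <= 2 `^ p * (a `^ p + b `^ p).
Proof.
move=> p0 a0 b0; wlog ab : a b a0 b0 / a <= b.
  move=> h; have [ab|/ltW ba] := leP a b; first exact: h.
  by rewrite addrC [X in _ * X]addrC h.
apply: (@le_trans _ _ ((2 * b) `^ p)).
  by rewrite ge0_ler_powR ?nnegrE ?addr_ge0 ?mulr_ge0//; lra.
by rewrite powRM// ler_wpM2l ?powR_ge0// lerDr powR_ge0.
Qed.

Variables (p : R) (p_gt0 : 0 < p) (x : nat -> E).
Implicit Types f g : E -> K.

Let q m f := \sum_(i < m) rnorm (f (x i)) `^ p.

Let q_add m f g h c : (forall z, rnorm (h z) <= rnorm (f z) + rnorm (g z)) ->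
  q m g <= c -> q m h <= 2 `^ p * (q m f + c).
Proof.
move=> hfg gc; apply: (@le_trans _ _ (2 `^ p * (q m f + q m g))).
  rewrite -big_split/= mulr_sumr; apply: ler_sum => i _.
  apply: le_trans (powR_add_le _ _ _); rewrite ?rnorm_ge0 ?(ltW p_gt0)//.
  by rewrite ge0_ler_powR ?(ltW p_gt0) ?nnegrE ?addr_ge0 ?rnorm_ge0.
by rewrite ler_wpM2l ?powR_ge0// lerD2l.
Qed.

(** A functional together with a radius for which the whole norm ball around it
    stays inside the dual ball. *)
Let inner (fr : (E -> K) * R) :=
  [/\ linear fr.1, 0 < fr.2 & forall z, rnorm (fr.1 z) <= (1 - fr.2) * rnorm z].

(** If the sums are unbounded over the dual ball, each inner ball contains a
    smaller one on which some finite sum is at least [L]: of [f + (r / 2) psi] and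
    [f - (r / 2) psi] one has a large sum as soon as [psi] does, because
    [r psi] is their difference. *)
Let gliding_step (L : R) (fr : (E -> K) * R) : inner fr ->
  (forall M, exists (phi : dual_ball E) m, M < q m (fun z => eval_at z phi)) ->
  exists fr', [/\ inner fr',
    forall z, rnorm (fr'.1 z - fr.1 z) <= (fr.2 - fr'.2) * rnorm z &
    exists m, forall g, (forall z, rnorm (g z - fr'.1 z) <= fr'.2 * rnorm z) ->
      L <= q m g].
Proof.
case: fr => f r [/= lf r0 fr] unb.
pose c : R := 2 `^ p; have c0 : 0 < c by rewrite powR_gt0.
have rp0 : 0 < r `^ p by rewrite powR_gt0.
have [psi [m psim]] := unb (c * (2 * (c * (L + 1))) / r `^ p).
have [lpsi psi1] := dual_ballP psi.
pose h : K := of_real (r / 2).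
have rh : rnorm h = r / 2 by rewrite rnorm_of_real ger0_norm// divr_ge0// ltW.
pose fp z := f z + h * eval_at z psi; pose fm z := f z - h * eval_at z psi.
have [f' [lf' f'f qf']] : exists f', [/\ linear f',
    forall z, rnorm (f' z - f z) <= r / 2 * rnorm z & c * (L + 1) <= q m f'].
  have lp : linear fp.
    by move=> a u v; rewrite /fp lf lpsi mulrDr mulrCA scalerDr addrACA.
  have lm : linear fm.
    move=> a u v; rewrite /fm lf lpsi mulrDr mulrCA scalerDr opprD addrACA.
    by rewrite scalerN.
  have dp z : rnorm (fp z - f z) <= r / 2 * rnorm z.
    rewrite /fp addrAC subrr add0r rnormM rh ler_wpM2l ?divr_ge0 ?(ltW r0)//.
  have dm z : rnorm (fm z - f z) <= r / 2 * rnorm z.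
    rewrite /fm addrAC subrr add0r rnormN rnormM rh ler_wpM2l ?divr_ge0 ?(ltW r0)//.
  have qpm : r `^ p * q m (fun z => eval_at z psi) <= c * (q m fp + q m fm).
    have := @q_add m fp fm (fun z => of_real r * eval_at z psi) _ _ (lexx _).
    have -> : q m (fun z => of_real r * eval_at z psi) = r `^ p * q m (fun z => eval_at z psi).
      rewrite /q mulr_sumr; apply: eq_bigr => i _.
      by rewrite rnormM rnorm_of_real powRM ?rnorm_ge0// ger0_norm// ltW.
    apply => z; have -> : of_real r * eval_at z psi = fp z - fm z.
      rewrite /fp /fm opprD opprK addrACA subrr add0r -mulrDl -of_realD.
      by congr (of_real _ * _); lra.
    by rewrite (le_trans (rnormD _ _))// rnormN.
  have : c * (2 * (c * (L + 1))) < c * (q m fp + q m fm).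
    apply: lt_le_trans qpm; rewrite -ltr_pdivrMl// mulrC //.
  rewrite ltr_pM2l// => qq.
  have [qp|qp] := leP (c * (L + 1)) (q m fp); first by exists fp.
  by exists fm; split => //; lra.
(* The radius r' is so small that moving by r' changes the p-norm of the first
   m values by at most 1. *)
pose S := \sum_(i < m) rnorm (x i) `^ p.
have S0 : 0 <= S by apply: sumr_ge0 => i _; exact: powR_ge0.
pose r' := Num.min (r / 2) ((S + 1)^-1 `^ p^-1).
have r'0 : 0 < r' by rewrite lt_min divr_gt0//= powR_gt0// invr_gt0; lra.
have r'r : r' <= r / 2 by rewrite ge_min lexx.
have r'S : r' `^ p * S <= 1.
  apply: (@le_trans _ _ ((S + 1)^-1 * S)).
    have -> : (S + 1)^-1 = ((S + 1)^-1 `^ p^-1) `^ p.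
      by rewrite -powRrM mulVf ?lt0r_neq0// powRr1// invr_ge0; lra.
    rewrite ler_wpM2r// ge0_ler_powR ?nnegrE ?powR_ge0 ?(ltW p_gt0) ?(ltW r'0)//.
    by rewrite ge_min lexx orbT.
  by rewrite mulrC ler_pdivrMr; lra.
exists (f', r'); split => /=.
- split => //= z.
  have -> : f' z = (f' z - f z) + f z by rewrite subrK.
  rewrite (le_trans (rnormD _ _))//.
  apply: (@le_trans _ _ (r / 2 * rnorm z + (1 - r) * rnorm z)); first exact: lerD.
  by rewrite -mulrDl ler_wpM2r ?rnorm_ge0//; lra.
- by move=> z; rewrite (le_trans (f'f z))// ler_wpM2r ?rnorm_ge0//; lra.
- exists m => g gf'.
  have := @q_add m g (fun z => f' z - g z) f' 1 _ _.
  rewrite -/c => hq; rewrite -(lerD2r 1) -(ler_pM2l c0) (le_trans qf')//.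
  apply: hq => [z|].
    by rewrite -{1}[f' z](subrK (g z)) addrC (le_trans (rnormD _ _)).
  apply: le_trans r'S; rewrite mulr_sumr; apply: ler_sum => i _.
  rewrite -powRM ?rnorm_ge0 ?(ltW r'0)//.
  rewrite ge0_ler_powR ?(ltW p_gt0) ?nnegrE ?rnorm_ge0 ?mulr_ge0 ?rnorm_ge0 ?(ltW r'0)//.
  by rewrite -rnormN opprB.
Qed.

(** Iterate [gliding_step] to get nested balls on which finite sums exceed every
    integer.  Weak-star compactness supplies a functional [psi] in all of them,
    which contradicts the summability of [psi] along [x]. *)
Lemma weakly_summable_bounded : weakly_summable p x ->
  exists M, forall (phi : dual_ball E) m,
    \sum_(i < m) rnorm (eval_at (x i) phi) `^ p <= M.
Proof.
move=> wx; apply: contrapT => nM.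
have unb M : exists (phi : dual_ball E) m, M < q m (fun z => eval_at z phi).
  apply: contrapT => nphi; apply: nM; exists M => phi m; rewrite leNgt.
  by apply/negP => Mq; apply: nphi; exists phi, m.
pose S := {fr | inner fr}.
have inner0 : inner (fun=> 0, 1).
  by split => //= [a u v|z]; rewrite ?scaler0 ?addr0// rnorm0 subrr mul0r.
have step (L : nat) (fr : S) : {fr' : S |
    (forall z, rnorm ((sval fr').1 z - (sval fr).1 z) <=
      ((sval fr).2 - (sval fr').2) * rnorm z) /\
    exists m, forall g, (forall z, rnorm (g z - (sval fr').1 z) <=
      (sval fr').2 * rnorm z) -> L%:R <= q m g}.
  apply: cid; case: fr => fr ifr.
  by have [fr' [ifr' h1 h2]] := gliding_step L%:R ifr unb; exists (exist _ fr' ifr').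
pose s := fix s (j : nat) : S :=
  if j is i.+1 then sval (step i (s i)) else exist _ _ inner0.
pose f j := (sval (s j)).1; pose r j := (sval (s j)).2.
have sP j : inner (f j, r j) by have := svalP (s j); rewrite /f /r -surjective_pairing.
have fS j z : rnorm (f j.+1 z - f j z) <= (r j - r j.+1) * rnorm z.
  by have [+ _] := svalP (step j (s j)); exact.
have fnest i j z : (i <= j)%N -> rnorm (f j z - f i z) <= (r i - r j) * rnorm z.
  elim: j => [|j ih]; first by rewrite leqn0 => /eqP ->; rewrite !subrr rnorm0 mul0r.
  rewrite leq_eqVlt => /predU1P[<-|]; first by rewrite !subrr rnorm0 mul0r.
  rewrite ltnS => /ih {}ih.
  have -> : r i - r j.+1 = (r j - r j.+1) + (r i - r j) by ring.
  rewrite mulrDl (le_trans _ (lerD (fS j z) ih))//.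
  by rewrite -[X in rnorm (X - f i z)](subrK (f j z)) -addrA rnormD.
have fball j : dual_ball_set (f j).
  have [/= lf r0 fr] := sP j; apply/dual_ball_setP; split => // z.
  by rewrite (le_trans (fr z))// ler_piMl ?rnorm_ge0// lerBlDr lerDl ltW.
pose phi j := to_dual_ball (fball j).
have [psi [_ cpsi]] := @dual_ball_compact R k E (phi @ \oo) _ filterT.
have psif j z : rnorm (eval_at z psi - f j z) <= r j * rnorm z.
  pose D := [set g : dual_ball E | rnorm (eval_at z g - f j z) <= r j * rnorm z].
  suff : D psi by [].
  have clD : closed D.
    have /continuous_closedP h : continuous (fun g : dual_ball E =>
        rnorm (eval_at z g - f j z)).
      move=> g; apply: (@continuous_comp _ _ _
        (fun g : dual_ball E => eval_at z g - f j z) (fun y => rnorm y)).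
        have ce := @eval_at_continuous R k E z g.
        have cc := @cvg_cst _ (f j z) _ _ (nbhs_filter g).
        by have /(_ (nbhs_filter _)) := cvgB ce cc.
      exact: rnorm_continuous.
    by apply: (h [set y | y <= r j * rnorm z]); exact: closed_le.
  rewrite (closure_id D).1//; move: cpsi; rewrite clusterE; apply.
  exists j => // i /= ji; rewrite /D /= eval_at_to_dual_ball.
  rewrite (le_trans (fnest _ _ z ji))// ler_wpM2r ?rnorm_ge0//.
  by have [/= _ r0 _] := sP i; rewrite lerBlDr lerDl ltW.
have [[lpsi cpsi'] _] := set_mem (valP psi).
have := wx _ (conj lpsi cpsi'); set T := (X in (X < _)%E) => Tfin.
have T0 : (0 <= T)%E by apply: nneseries_ge0 => i _ _; rewrite lee_fin powR_ge0.
have Tf : T \is a fin_num by rewrite ge0_fin_numE.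
have qT m : q m (fun z => eval_at z psi) <= fine T.
  rewrite -lee_fin fineK// /q -sumEFin -(big_mkord xpredT
    (fun i => (rnorm (eval_at (x i) psi) `^ p)%:E)).
  by apply: nneseries_lim_ge => i _ _; rewrite lee_fin powR_ge0.
have [L TL] : exists L : nat, fine T < L%:R.
  by exists (Num.bound (fine T)); rewrite archi_boundP// fine_ge0.
have [_ [m hm]] := svalP (step L (s L)).
have := hm (fun z => eval_at z psi) (psif L.+1).
by rewrite leNgt (le_lt_trans (qT m) TL).
Qed.

End WeakSummability.

(** * Regular probabilities from positive functionals on the dual ball *)
Section RieszDualBall.
Context {R : realType} {k : scalar_field} {E : normedModType (scalars R k)}.
Local Notation B := (dual_ball E).

Lemma dual_ball_open_measurable (U : set B) : open U -> measurable U.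
Proof. exact: sub_sigma_algebra. Qed.

Lemma dual_ball_continuous_measurable (g : B -> R) : continuous g -> measurable_fun setT g.
Proof.
move=> /continuousP cg; apply: (measurability _ (RGenOpens.measurableE R)).
move=> _ [_ [a [b ->] <-]]; rewrite setTI.
by apply: dual_ball_open_measurable; apply: cg; exact: interval_open.
Qed.

Section Restriction.
Variable m : {outer_measure set B -> \bar R}.
Hypothesis m_open : forall U, open U -> caratheodory_measurable m U.
Hypothesis m1 : m setT = 1%E.

(** The measurable sets are generated by the open ones. *)
Lemma caratheodory_borel (A : set B) : measurable A -> caratheodory_measurable m A.
Proof.
move=> mA; apply: (smallest_sub _ m_open mA); split.
- exact: caratheodory_measurable_set0.
- by move=> U mU; rewrite setTD; exact: caratheodory_measurable_setC.
- by move=> F mF; exact: caratheodory_measurable_bigcup.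
Qed.

Lemma borel_sigma_additive : semi_sigma_additive (m : set B -> \bar R).
Proof.
move=> F mF tF mU.
apply: (@caratheodory_measure_sigma_additive R B m F) => //.
- by move=> i; exact: caratheodory_borel.
- exact: caratheodory_borel.
Qed.

Lemma borel_restriction : exists mu : probability B R, forall A, mu A = m A.
Proof.
pose mu : set B -> \bar R := m.
pose mu1 : {measure set B -> \bar R} := HB.pack mu
  (isMeasure.Build _ _ _ mu (outer_measure0 m) (outer_measure_ge0 m)
     borel_sigma_additive).
pose mu2 : probability B R := HB.pack mu
  (isMeasure.Build _ _ _ mu (outer_measure0 m) (outer_measure_ge0 m)
     borel_sigma_additive)
  (Measure_isProbability.Build _ _ R mu1 m1).
by exists mu2.
Qed.

End Restriction.

(** Outer regularity is built into the outer measure; inner regularity follows by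
    taking complements, since the total mass is finite and closed sets are
    compact.  For the integral inequality slice [h] into layers [c j] of height
    [e]: each [c j] is [e] times a test function for the open set [U j] where
    [h > j e], and the step function [\sum_j e * \1_(U j)] is at most
    [h + e]. *)
Theorem riesz_dual_ball (L : (B -> R) -> R) : positive_functional L ->
  exists mu : probability B R, regular_measure mu /\
    forall (h : B -> R) (M : R), continuous h -> (forall phi, 0 <= h phi <= M) ->
      ((L h)%:E <= \int[mu]_phi (h phi)%:E)%E.
Proof.
move=> Lpos; have cB := @dual_ball_compact R k E; have hB := @dual_ball_hausdorff R k E.
have [m [m_open m1 m_outer m_sub]] := riesz_outer_measure Lpos cB hB.
have [mu mum] := borel_restriction m_open m1.
exists mu.
have outer A : mu A = ereal_inf [set mu U | U in [set U | open U /\ A `<=` U]].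
  by rewrite mum m_outer; congr ereal_inf; apply/seteqP; split=> _ [U AU <-];
    exists U.
split.
  move=> A mA; split; last exact: outer.
  apply/eqP; rewrite eq_le; apply/andP; split; last first.
    apply: ge_ereal_sup => _ [C [_ CA] <-].
    by change (mu C <= mu A)%E; rewrite !mum; exact: le_outer_measure.
  change (mu A <= ereal_sup [set mu C | C in [set C | compact C /\ C `<=` A]])%E.
  (* Open supersets of ~` A have compact complements inside A. *)
  have mC := probability_setC mu mA.
  apply/lee_addgt0Pr => e e0.
  have mfin C : measurable C -> mu C \is a fin_num by exact: fin_num_measure.
  have Cfin : mu (~` A) \is a fin_num by apply: mfin; exact: measurableC.
  have [_ [U [oU CU] <-]] : exists2 x, [set mu U | U in [set U | open U /\ ~` A `<=` U]] x &
      (x < mu (~` A) + e%:E)%E.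
    by apply: ereal_inf_lt; rewrite -outer lteDl.
  have mU : measurable U by exact: dual_ball_open_measurable.
  move=> Ue; apply: (@le_trans _ _ (mu (~` U) + e%:E)%E); last first.
    rewrite leeD2r//; apply: ereal_sup_ubound; exists (~` U) => //; split.
      by apply: subclosed_compact cB _ => //; exact: open_closedC.
    by rewrite -[A]setCK; exact: subsetC.
  move: Ue; rewrite probability_setC// probability_setC//.
  have := mfin _ mA.
  have := mfin _ mU.
  move: (mu A) (mu U) => [a| |] [u| |]//= _ _.
  by rewrite -!EFinB -!EFinD lte_fin lee_fin; lra.
move=> h M ch hM; apply/lee_addgt0Pr => e e0.
have [N MN] : exists N : nat, M <= N%:R * e.
  exists (Num.bound (M / e)); rewrite -ler_pdivrMr// ltW// archi_boundP// divr_ge0 ?(ltW e0)//.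
  by have /andP[] := hM point; exact: le_trans.
pose c j (phi : B) := Num.min (h phi) (j.+1%:R * e) - Num.min (h phi) (j%:R * e).
have [LD LZ _ _] := Lpos.
have cmin (a : R) : continuous (fun phi => Num.min (h phi) a).
  move=> phi; apply: (@continuous_min R B h (fun=> a)); first exact: ch.
  by apply: cvg_cst; exact: nbhs_filter.
have cc j : continuous (c j).
  move=> phi; exact: (cvgB (cmin (j.+1%:R * e) phi) (cmin (j%:R * e) phi)).
have je j : (j%:R * e <= j.+1%:R * e :> R) by rewrite ler_wpM2r ?(ltW e0)// ler_nat.
have cje j phi : 0 <= c j phi <= e.
  have ee : j.+1%:R * e = j%:R * e + e :> R by rewrite -natr1 mulrDl mul1r.
  rewrite /c; have := je j; rewrite ee !minEle.
  by do 2![case: ifPn; rewrite -?ltNge]; lra.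
have Lsum (n : nat) : L (fun phi => \sum_(j < n) c j phi) = \sum_(j < n) L (c j) /\
    continuous (fun phi => \sum_(j < n) c j phi).
  elim: n => [|n [ih1 ih2]].
    rewrite !big_ord0; split.
      under eq_fun do rewrite big_ord0; exact: positive_functional_cst.
    under eq_fun do rewrite big_ord0; move=> phi; by apply: cvg_cst; exact: nbhs_filter.
  have e1 : (fun phi => \sum_(j < n.+1) c j phi) =
      (fun phi => \sum_(j < n) c j phi) \+ c n.
    by apply/funext => phi; rewrite big_ord_recr.
  rewrite e1 big_ord_recr/= LD// ih1; split => //.
  by move=> phi; exact: (cvgD (ih2 phi) (cc n phi)).
have hsum : h = fun phi => \sum_(j < N) c j phi.
  apply/funext => phi.
  rewrite -(big_mkord xpredT (c ^~ phi)) (@telescope_sumr _ 0 N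
    (fun j => Num.min (h phi) (j%:R * e)))//.
  have /andP[h0 hm] := hM phi; rewrite mul0r (min_r h0) subr0 min_l//.
  exact: le_trans MN.
pose U j := [set phi | j%:R * e < h phi].
have oU j : open (U j).
  by have /continuousP cho := ch; apply: (cho [set y | j%:R * e < y]); exact: open_gt.
have LU j : ((L (c j))%:E <= e%:E * mu (U j))%E.
  have -> : c j = fun phi => e * (e^-1 * c j phi).
    by apply/funext => phi; rewrite mulrA divff ?mul1r// gt_eqF.
  have cc' : continuous (fun phi => e^-1 * c j phi).
    by move=> phi; exact: (cvgMr (cc j phi)).
  rewrite LZ// EFinM lee_pmul2l ?lte_fin// mum; apply: m_sub => //.
  split => // phi.
    have /andP[c0 ce] := cje j phi.
    by rewrite mulr_ge0 ?invr_ge0 ?(ltW e0)//= mulrC ler_pdivrMr// mul1r.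
  move=> /negP; rewrite -leNgt => hj; rewrite /c !min_l ?subrr ?mulr0//.
  exact: le_trans hj _.
have mh : measurable_fun setT h by exact: dual_ball_continuous_measurable.
have mU j : measurable (U j) by exact: dual_ball_open_measurable.
rewrite [X in (L X)%:E]hsum (Lsum N).1 -sumEFin.
apply: (@le_trans _ _ (\sum_(j < N) (e%:E * mu (U j)))%E).
  by apply: lee_sum => j _; exact: LU.
have -> : (\sum_(j < N) (e%:E * mu (U j)) =
    \int[mu]_phi (\sum_(j < N) (e * \1_(U j) phi)%:E))%E.
  rewrite ge0_integral_sum//; last 2 first.
  - move=> j; apply/measurable_EFinP; apply: measurable_funM => //.
  - by move=> j phi _; rewrite lee_fin mulr_ge0// ltW.
  apply: eq_bigr => j _.
  under eq_integral do rewrite EFinM.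
  rewrite ge0_integralZl//; [|exact/measurable_EFinP/measurable_indic
    |by rewrite lee_fin ltW].
  by rewrite integral_indic// setIT.
have -> : (\int[mu]_phi (h phi)%:E + e%:E = \int[mu]_phi ((h phi)%:E + e%:E))%E.
  rewrite ge0_integralD//; last 3 first.
  - by move=> phi _; rewrite lee_fin; have /andP[] := hM phi.
  - exact/measurable_EFinP.
  - by move=> phi _; rewrite lee_fin ltW.
  by rewrite integral_cst//= probability_setT mule1.
apply: ge0_le_integral => //.
- by move=> phi _; apply: sume_ge0 => j _; rewrite lee_fin mulr_ge0// ltW.
- apply: emeasurable_sum => j; apply/measurable_EFinP; apply: measurable_funM => //.
- by apply: emeasurable_funD; exact/measurable_EFinP.
move=> phi _; rewrite sumEFin -EFinD lee_fin.
have /andP[h0 hm] := hM phi.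
pose b j := Num.min (h phi + e) (j%:R * e).
apply: (@le_trans _ _ (\sum_(j < N) (b j.+1 - b j))).
  apply: ler_sum => j _.
  have ee : j.+1%:R * e = j%:R * e + e :> R by rewrite -natr1 mulrDl mul1r.
  rewrite /b; have := je j; rewrite ee => jee.
  have [hj|hj] := ltP (j%:R * e) (h phi).
    rewrite indicE mem_set// mulr1 !minEle.
    by do 2![case: ifPn; rewrite -?ltNge]; lra.
  rewrite indicE memNset ?mulr0 /U/= ?ltNge ?hj// !minEle.
  by do 2![case: ifPn; rewrite -?ltNge]; lra.
rewrite -(big_mkord xpredT (fun j => b j.+1 - b j)) telescope_sumr//.
by rewrite /b mul0r (min_r (addr_ge0 h0 (ltW e0))) subr0 ge_min lexx.
Qed.

End RieszDualBall.

(** * Pietsch domination from inequalities on finite families *)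
Section ContinuousFunctions.
Context {R : realType} {T : topologicalType}.

Definition continuous_pred : {pred T -> R} := fun f => `[< continuous f >].

Lemma continuous_submod_closed : submod_closed continuous_pred.
Proof.
split; first by apply/asboolP => x; apply: cvg_cst; exact: nbhs_filter.
move=> a f g /asboolP cf /asboolP cg; apply/asboolP => x.
exact: (cvgD (cvgMr (cf x)) (cg x)).
Qed.

HB.instance Definition _ :=
  GRing.isSubmodClosed.Build _ _ continuous_pred continuous_submod_closed.

Definition continuous_fun : Type := {f : T -> R | f \in continuous_pred}.
HB.instance Definition _ := [isSub for @sval _ _ : continuous_fun -> (T -> R)].
HB.instance Definition _ := [Choice of continuous_fun by <:].
HB.instance Definition _ := [SubChoice_isSubLmodule of continuous_fun by <:].

Definition to_continuous_fun (f : T -> R) (cf : continuous f) : continuous_fun :=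
  exist _ f (asboolT cf).

Lemma continuous_funP (f : continuous_fun) : continuous (val f).
Proof. exact/asboolP/(valP f). Qed.

Lemma positive_functional_extend (L : continuous_fun -> R) :
  (forall f g, L (f + g) = L f + L g) -> (forall a f, L (a *: f) = a * L f) ->
  (forall f, (forall x, 0 <= val f x) -> 0 <= L f) ->
  (forall f, (forall x, val f x = 1) -> L f = 1) ->
  exists L' : (T -> R) -> R, positive_functional L' /\
    forall f : continuous_fun, L' (val f) = L f.
Proof.
move=> LD LZ L0 L1.
pose L' f := if insub f is Some u then L u else 0.
have L'E (f : continuous_fun) : L' (val f) = L f by rewrite /L' valK.
have L'E' f (cf : continuous f) : L' f = L (to_continuous_fun cf).
  exact: L'E (to_continuous_fun cf).
exists L'; split => //; split.
- move=> f g cf cg; rewrite (L'E' _ cf) (L'E' _ cg) -LD -L'E.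
  by congr L'.
- move=> a f cf; rewrite (L'E' _ cf) -LZ -L'E.
  by congr L'.
- by move=> f cf f0; rewrite (L'E' _ cf); exact: L0.
- have c1 : continuous (fun _ : T => 1 : R).
    by move=> x; apply: cvg_cst; exact: nbhs_filter.
  by rewrite (L'E' _ c1); exact: L1.
Qed.

End ContinuousFunctions.

(** The base must be nonnegative: at a negative base the power function takes the
    value 1, so that it jumps at 0. *)
Lemma powR_continuous (R : realType) (T : topologicalType) (h : T -> R) (p : R) :
  0 < p -> continuous h -> (forall x, 0 <= h x) -> continuous (fun x => h x `^ p).
Proof.
move=> p0 ch h0 x; have [hx|hx] := eqVneq (h x) 0.
  apply/(@cvgrPdist_lt _ _ _ (nbhs x)) => e e0; rewrite hx powR0 ?gt_eqF//.
  have /cvgrPdist_lt/(_ (e `^ p^-1)) := ch x; rewrite powR_gt0// => /(_ isT).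
  apply: filterS => y; rewrite hx !sub0r !normrN !ger0_norm ?powR_ge0// => hy.
  have := gt0_ltr_powR p0 _ _ hy; rewrite !nnegrE powR_ge0 h0 => /(_ isT isT).
  by rewrite -powRrM mulVf ?gt_eqF// powRr1// ltW.
have {}hx : 0 < h x by rewrite lt_neqAle eq_sym hx h0.
have /= : (fun y => expR (p * ln (h y))) y @[y --> x] --> expR (p * ln (h x)).
  apply: continuous_comp; last exact: continuous_expR.
  have cl : (fun y => ln (h y)) y @[y --> x] --> ln (h x).
    by apply: (@continuous_comp _ _ _ h (@ln R)); [exact: ch | exact: continuous_ln].
  exact: cvgMr cl.
rewrite /continuous_at {2}/powR gt_eqF// => cexp.
apply: cvg_trans cexp; apply: near_eq_cvg.
have hpos : \forall y \near x, 0 < h y by exact: (cvgr_gt _ (ch x)).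
by apply: filterS hpos => y hy; rewrite /powR gt_eqF.
Qed.

Section Pietsch.
Context {R : realType} {k : scalar_field} {E F : normedModType (scalars R k)}.
Local Notation K := (scalars R k).
Local Notation B := (dual_ball E).
Variables (n : nat) (n_gt0 : (0 < n)%N) (p : R) (p_gt0 : 0 < p) (P : E -> F).

(** The inequality [\sum |P x| ^ (p/n) <= D sup_phi \sum |phi x| ^ p] for finite
    families; quantifying over upper bounds [M] replaces the supremum. *)
Definition family_domination (D : R) : Prop :=
  forall (s : seq E) (M : R),
    (forall phi : B, \sum_(x <- s) rnorm (eval_at x phi) `^ p <= M) ->
    \sum_(x <- s) rnorm (P x) `^ (p / n%:R) <= D * M.

Definition rhomogeneous : Prop := forall (t : R) x, 0 <= t ->
  rnorm (P (of_real t *: x)) = t ^+ n * rnorm (P x).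

Lemma rnorm_eval_at_continuous x : continuous (fun phi : B => rnorm (eval_at x phi) `^ p).
Proof.
apply: powR_continuous => // [phi|phi]; last exact: rnorm_ge0.
apply: (@continuous_comp _ _ _ (eval_at x) (fun z : K => rnorm z)).
  exact: eval_at_continuous.
exact: rnorm_continuous.
Qed.

Lemma homogeneous_powR_scale t x : rhomogeneous -> 0 <= t ->
  rnorm (P (of_real t *: x)) `^ (p / n%:R) = t `^ p * rnorm (P x) `^ (p / n%:R).
Proof.
move=> hP t0; rewrite hP// powRM ?exprn_ge0 ?rnorm_ge0//; congr (_ * _).
by rewrite -powR_mulrn// -powRrM mulrCA mulfV ?mulr1// pnatr_eq0 -lt0n.
Qed.

Lemma eval_at_powR_scale t x (phi : B) : 0 <= t ->
  rnorm (eval_at (of_real t *: x) phi) `^ p = t `^ p * rnorm (eval_at x phi) `^ p.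
Proof.
by move=> t0; rewrite eval_atZ rnormM rnorm_of_real (ger0_norm t0) powRM ?rnorm_ge0.
Qed.

(** Separate the convex cone spanned by the functions
    [a x - D * g x], where [a x = |P x| ^ (p/n)] and [g x phi = |phi x| ^ p],
    from the positive functions.  It is stable under addition (concatenate
    families) and under positive factors (rescale the vectors by the [p]-th root),
    and [family_domination] says that no member of it is bounded below by a
    positive constant.  So the infimum over the cone of the upper bounds of
    [f - q] is a finite sublinear functional of [f]; a linear functional below it
    is positive, normalized, and nonpositive on the cone. *)
Theorem pietsch_domination D : rhomogeneous -> 0 <= D -> family_domination D ->
  exists mu : probability B R, regular_measure mu /\
    forall x, ((rnorm (P x) `^ (p / n%:R))%:E <=
      D%:E * \int[mu]_phi (rnorm (eval_at x phi) `^ p)%:E)%E.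
Proof.
move=> hP D0 famD.
pose V := @continuous_fun R B.
pose a x := rnorm (P x) `^ (p / n%:R).
pose g x (phi : B) := rnorm (eval_at x phi) `^ p.
have gle x phi : 0 <= g x phi <= rnorm x `^ p.
  rewrite powR_ge0/= ge0_ler_powR ?(ltW p_gt0) ?nnegrE ?rnorm_ge0//.
  by have [_ ->] := dual_ballP phi.
pose S (f : V) : set R := [set r | exists xs : seq E, forall phi,
  val f phi - \sum_(x <- xs) (a x - D * g x phi) <= r].
have bnd (f : V) : exists M, forall phi, `|val f phi| <= M.
  have cN : continuous (fun phi => `|val f phi|).
    move=> phi; apply: (@continuous_comp _ _ _ (val f) (fun r : R => `|r|)).
      exact: continuous_funP.
    exact: norm_continuous.
  have [|c _ cmax] := @compact_EVT_max B R _ setT _ (@dual_ball_compact R k E)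
      (continuous_subspaceT cN).
    by exists point.
  by exists `|val f c| => phi; apply: cmax; rewrite inE.
have valD (f f' : V) phi : val (f + f') phi = val f phi + val f' phi by [].
have valZ t (f : V) phi : val (t *: f) phi = t * val f phi by [].
have valN (f : V) phi : val (- f) phi = - val f phi by [].
have Sinf f : has_inf (S f).
  have [M fM] := bnd f; split.
    exists M, [::] => phi; rewrite big_nil subr0.
    exact: le_trans (ler_norm _) (fM phi).
  exists (- M) => r [xs fr]; rewrite leNgt; apply/negP => rM.
  pose A := \sum_(x <- xs) a x; pose G := \sum_(x <- xs) rnorm x `^ p.
  have h phi : D * \sum_(x <- xs) g x phi <= A - (- M - r).
    have := fr phi; rewrite sumrB -mulr_sumr -/A.
    have := fM phi; rewrite ler_norml => /andP[+ _]; lra.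
  (* For D = 0 the values of the family vanish, whatever the bound. *)
  have [D00|Dn0] := eqVneq D 0.
    have := famD xs G; rewrite D00 mul0r => /(_ _)/wrap[].
      by move=> phi; apply: ler_sum => x _; have /andP[] := gle x phi.
    by have := h point; rewrite D00 mul0r -/A; lra.
  have {}Dn0 : 0 < D by rewrite lt_neqAle eq_sym Dn0.
  have := famD xs ((A - (- M - r)) / D) => /(_ _)/wrap[].
    by move=> phi; rewrite ler_pdivlMr// mulrC; exact: h.
  by rewrite mulrCA divff ?gt_eqF// mulr1 -/A; lra.
have Ssub : sublinear (fun f => inf (S f)).
  apply: inf_sublinear => //.
    move=> u v r1 r2 [xs1 h1] [xs2 h2]; exists (r1 + r2) => //.
    exists (xs1 ++ xs2) => phi; rewrite big_cat valD/=.
    by have := h1 phi; have := h2 phi => /=; lra.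
  move=> t u r t0 [xs h]; exists (t * r) => //.
  exists [seq of_real (t `^ p^-1) *: x | x <- xs] => phi; rewrite big_map.
  have tp : (t `^ p^-1) `^ p = t.
    by rewrite -powRrM mulVf ?gt_eqF// powRr1// ltW.
  under eq_bigr => x _ do rewrite /a /g homogeneous_powR_scale ?powR_ge0//
    eval_at_powR_scale ?powR_ge0//
    tp mulrCA -mulrBr.
  by rewrite -mulr_sumr valZ -mulrBr ler_pM2l.
have [L [LD LZ Ls]] := hahn_banach Ssub.
have LN f : L (- f) = - L f by rewrite -scaleN1r LZ mulN1r.
have Lle (f : V) r : (forall phi, val f phi <= r) -> L f <= r.
  move=> fr; apply: le_trans (Ls f) _; apply: ge_inf; first exact: (Sinf f).2.
  by exists [::] => phi; rewrite big_nil subr0.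
have [L' [L'pos L'E]] : exists L' : (B -> R) -> R, positive_functional L' /\
    forall f : V, L' (val f) = L f.
  apply: positive_functional_extend => // f f0.
    by rewrite -oppr_le0 -LN; apply: Lle => phi; rewrite valN oppr_le0.
  apply/eqP; rewrite eq_le Lle => [/=|phi]; last by rewrite f0.
  by rewrite -lerN2 -LN; apply: Lle => phi; rewrite valN f0.
have [mu [rmu Lmu]] := riesz_dual_ball L'pos.
exists mu; split => // x.
have cg := @rnorm_eval_at_continuous x.
apply: (@le_trans _ _ (D%:E * (L' (g x))%:E)%E); last first.
  by rewrite lee_wpmul2l ?lee_fin//; exact: Lmu cg (gle x).
rewrite -EFinM lee_fin.
have ca : continuous (fun _ : B => a x).
  by move=> phi; apply: cvg_cst; exact: nbhs_filter.
pose G : V := to_continuous_fun cg; pose A : V := to_continuous_fun ca.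
have LA : a x <= L A.
  by rewrite -lerN2 -LN; apply: Lle => phi; rewrite valN.
have : L (A - D *: G) <= 0.
  apply: le_trans (Ls _) _; apply: ge_inf; first exact: (Sinf _).2.
  by exists [:: x] => phi; rewrite big_seq1 valD valN valZ subrr.
rewrite LD LN LZ subr_le0 -(L'E G); exact: le_trans.
Qed.

End Pietsch.

(** * Dominated polynomials and the dominated norm *)
Section FamilyDomination.
Context {R : realType} {k : scalar_field} {E F : normedModType (scalars R k)}.
Local Notation K := (scalars R k).
Local Notation B := (dual_ball E).
Variables (n : nat) (n_gt0 : (0 < n)%N) (p : R) (p_gt0 : 0 < p) (P : E -> F).
Implicit Types mu : probability B R.

Let nR_gt0 : 0 < n%:R :> R. Proof. by rewrite ltr0n. Qed.
Let np_K (a : R) : 0 <= a -> (a `^ (n%:R / p)) `^ (p / n%:R) = a.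
Proof.
by move=> a0; rewrite -powRrM mulrA divfK ?gt_eqF// divff ?gt_eqF// powRr1.
Qed.
Let pn_K (a : R) : 0 <= a -> (a `^ (p / n%:R)) `^ (n%:R / p) = a.
Proof.
by move=> a0; rewrite -powRrM mulrA divfK ?gt_eqF// divff ?gt_eqF// powRr1.
Qed.

(** The [p]-th power of the norm in [L_p(mu)] of the evaluation at [x]. *)
Definition eval_moment mu (x : E) : R := fine (\int[mu]_phi (rnorm (eval_at x phi) `^ p)%:E).

Let measurable_eval (x : E) :
  measurable_fun setT (fun phi : B => (rnorm (eval_at x phi) `^ p)%:E).
Proof.
apply/measurable_EFinP; apply: dual_ball_continuous_measurable.
exact: rnorm_eval_at_continuous.
Qed.

Lemma eval_momentE mu x :
  (\int[mu]_phi (rnorm (eval_at x phi) `^ p)%:E)%E = (eval_moment mu x)%:E.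
Proof.
rewrite fineK// ge0_fin_numE; last by apply: integral_ge0 => phi _; rewrite lee_fin powR_ge0.
apply: (@le_lt_trans _ _ (\int[mu]_(phi in setT) (cst (rnorm x `^ p)%:E) phi)%E).
  apply: ge0_le_integral => //.
  - by move=> phi _; rewrite lee_fin powR_ge0.
  move=> phi _; rewrite lee_fin ge0_ler_powR ?(ltW p_gt0) ?nnegrE ?rnorm_ge0//.
  by have [_ ->] := dual_ballP phi.
by rewrite integral_cst//= probability_setT mule1 ltry.
Qed.

Lemma eval_moment_ge0 mu x : 0 <= eval_moment mu x.
Proof. by apply: fine_ge0; apply: integral_ge0 => phi _; rewrite lee_fin powR_ge0. Qed.

Lemma dominationP mu C : domination n p P mu C <->
  forall x, rnorm (P x) <= C * eval_moment mu x `^ (n%:R / p).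
Proof.
split=> h x; have := h x; first by rewrite eval_momentE poweR_EFin -EFinM lee_fin.
by rewrite eval_momentE poweR_EFin -EFinM lee_fin.
Qed.

(** The same domination with the exponent moved to the left, the form that can be
    summed over a family. *)
Lemma domination_pow mu C : 0 <= C -> domination n p P mu C <->
  forall x, rnorm (P x) `^ (p / n%:R) <= C `^ (p / n%:R) * eval_moment mu x.
Proof.
move=> C0; have np0 : 0 <= n%:R / p by rewrite divr_ge0// ltW.
have pn0 : 0 <= p / n%:R by rewrite divr_ge0// ltW.
split=> [/dominationP h x|h].
  rewrite -[eval_moment mu x](np_K (eval_moment_ge0 mu x)) -powRM ?powR_ge0//.
  by rewrite ge0_ler_powR ?nnegrE ?rnorm_ge0// mulr_ge0// powR_ge0.
apply/dominationP => x.
rewrite -[leLHS](pn_K (rnorm_ge0 (P x))) -[C in leRHS](pn_K C0) -powRM ?powR_ge0 ?eval_moment_ge0//.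
apply: ge0_ler_powR => //; rewrite nnegrE ?powR_ge0//.
by rewrite mulr_ge0 ?powR_ge0 ?eval_moment_ge0.
Qed.

Lemma domination_family mu C : 0 <= C -> domination n p P mu C ->
  family_domination n p P (C `^ (p / n%:R)).
Proof.
move=> C0 /(domination_pow _ C0) h s M sM.
apply: (@le_trans _ _ (C `^ (p / n%:R) * \sum_(x <- s) eval_moment mu x)).
  by rewrite mulr_sumr; apply: ler_sum => x _; exact: h.
rewrite ler_wpM2l ?powR_ge0// -lee_fin -sumEFin.
under eq_bigr do rewrite -eval_momentE.
rewrite -ge0_integral_sum//; last by move=> x phi _; rewrite lee_fin powR_ge0.
apply: (@le_trans _ _ (\int[mu]_(phi in setT) (cst M%:E) phi)%E).
  apply: ge0_le_integral => //.
  - by move=> phi _; apply: sume_ge0 => x _; rewrite lee_fin powR_ge0.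
  - exact: emeasurable_sum.
  - by move=> phi _; rewrite sumEFin lee_fin.
by rewrite integral_cst//= probability_setT mule1.
Qed.

Lemma nneseries_bounded (u : nat -> R) M : (forall i, 0 <= u i) ->
  (forall m, \sum_(i < m) u i <= M) -> (\sum_(0 <= i <oo) (u i)%:E < +oo)%E.
Proof.
move=> u0 uM; apply: (@le_lt_trans _ _ M%:E); last exact: ltry.
apply: lime_le; first by apply: is_cvg_nneseries => i _ _; rewrite lee_fin.
by apply: nearW => m; rewrite big_mkord sumEFin lee_fin.
Qed.

(** Uniform boundedness gives one bound [M] for all partial sums. *)
Lemma family_dominated D : 0 <= D -> family_domination n p P D -> dominated n p P.
Proof.
move=> D0 fam x /(weakly_summable_bounded p_gt0)[M hM].
apply: (@nneseries_bounded _ (D * M)) => [i|m]; first exact: powR_ge0.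
have := fam (map x (iota 0 m)) M; rewrite big_map => h.
have e (f : nat -> R) : \sum_(i < m) f i = \sum_(i <- iota 0 m) f i.
  by rewrite -(big_mkord xpredT f) /index_iota subn0.
rewrite (e (fun i => rnorm (P (x i)) `^ (p / n%:R))); apply: h => phi.
by rewrite big_map -(e (fun i => rnorm (eval_at (x i) phi) `^ p)).
Qed.

Lemma pietsch_dominated D : rhomogeneous n P -> 0 <= D -> family_domination n p P D ->
  exists mu, regular_measure mu /\ domination n p P mu (D `^ (n%:R / p)).
Proof.
move=> hP D0 /(pietsch_domination n_gt0 p_gt0 hP D0)[mu [rmu h]].
exists mu; split => //; apply/domination_pow; first exact: powR_ge0.
by move=> x; have := h x; rewrite eval_momentE -EFinM lee_fin np_K.
Qed.

(** Since no [s m] is empty, the concatenation of the first [i.+1] of them has an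
    [i]-th entry, and later concatenations have the same one. *)
Lemma concat_sequence (T : Type) (s : nat -> seq T) :
  (forall m, (0 < size (s m))%N) -> exists x : nat -> T, forall m,
    exists2 N, (m <= N)%N & map x (iota 0 N) = flatten (mkseq s m).
Proof.
move=> s0; pose S m := flatten (mkseq s m).
have SS m : S m.+1 = S m ++ s m.
  by rewrite /S /mkseq -addn1 iotaD map_cat flatten_cat /= cats0.
have sizeS m : (m <= size (S m))%N.
  by elim: m => // m ih; rewrite SS size_cat -addn1 leq_add.
have t0 : T by case: (s 0%N) (s0 0%N).
have nthS i m m' : (i < size (S m))%N -> (m <= m')%N -> nth t0 (S m') i = nth t0 (S m) i.
  move=> im; elim: m' => [|m' ih]; first by rewrite leqn0 => /eqP ->.
  rewrite leq_eqVlt => /predU1P[->//|]; rewrite ltnS => mm'.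
  rewrite SS nth_cat ih//; case: ifPn => // /negP[].
  apply: leq_trans im _; elim: m' mm' {ih} => [|m' ih]; first by rewrite leqn0 => /eqP ->.
  rewrite leq_eqVlt => /predU1P[->//|]; rewrite ltnS => /ih; rewrite SS size_cat.
  by move=> /leq_trans; apply; exact: leq_addr.
exists (fun i => nth t0 (S i.+1) i) => m; exists (size (S m)) => //.
rewrite -/(S m) -[RHS](mkseq_nth t0); rewrite /mkseq; apply/eq_in_map => i.
rewrite mem_iota add0n => /andP[_ im].
by have [mi|/ltnW im'] := leqP m i.+1; [rewrite (nthS i m) | rewrite -(nthS i i.+1 m)// sizeS].
Qed.

(** If no constant works, then for each [j] some finite family violates the
    inequality with constant [2 ^ j].  Rescaled by [t], its sums over functionals
    are at most [2 ^ - j] while its values add up to at least 1; gluing these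
    families gives a weakly summable sequence with a divergent sum of values. *)
Lemma dominated_family : rhomogeneous n P -> dominated n p P ->
  exists2 D, 0 <= D & family_domination n p P D.
Proof.
move=> hP domP; apply: contrapT => nD.
pose a x := rnorm (P x) `^ (p / n%:R).
pose g x (phi : B) := rnorm (eval_at x phi) `^ p.
have step (j : nat) : exists s : seq E,
    (forall phi : B, \sum_(x <- s) g x phi <= (2 ^+ j)^-1) /\ 1 <= \sum_(x <- s) a x.
  have [s [M [sM Ms]]] : exists (s : seq E) M, (forall phi : B, \sum_(x <- s) g x phi <= M) /\
      2 ^+ j * M < \sum_(x <- s) a x.
    apply: contrapT => ns; apply: nD; exists (2 ^+ j); first exact: exprn_ge0.
    move=> s M sM; rewrite leNgt; apply/negP => Ms; apply: ns.
    by exists s, M.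
  have M0 : 0 <= M by apply: le_trans (sM point); apply: sumr_ge0 => x _; exact: powR_ge0.
  have j0 : 0 < 2 ^+ j :> R by rewrite exprn_gt0.
  (* M may be 0; the larger bound M' is positive and turns the inequality into
     an equality. *)
  pose M' := (\sum_(x <- s) a x) / 2 ^+ j.
  have MM' : M < M' by rewrite ltr_pdivlMr// mulrC.
  have M'0 : 0 < M' by exact: le_lt_trans MM'.
  pose c := (2 ^+ j * M')^-1; have c0 : 0 < c by rewrite invr_gt0 mulr_gt0.
  pose t := c `^ p^-1; have t0 : 0 <= t by exact: powR_ge0.
  have tp : t `^ p = c by rewrite -powRrM mulVf ?gt_eqF// powRr1// ltW.
  exists [seq of_real t *: x | x <- s]; split.
    move=> phi; rewrite big_map.
    under eq_bigr do rewrite /g eval_at_powR_scale// tp.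
    rewrite -mulr_sumr /c invfM -mulrA ler_piMr ?invr_ge0 ?(ltW j0)//.
    by rewrite ler_pdivrMl// mulr1 (le_trans (sM phi))// ltW.
  rewrite big_map; under eq_bigr do rewrite /a homogeneous_powR_scale// tp.
  rewrite -mulr_sumr /c /M' mulrCA divff ?gt_eqF// mulr1 mulVf// gt_eqF//.
  by apply: le_lt_trans Ms; rewrite mulr_ge0// ltW.
pose s j := projT1 (cid (step j)).
have sg j phi : \sum_(x <- s j) g x phi <= (2 ^+ j)^-1 by have [] := projT2 (cid (step j)).
have sa j : 1 <= \sum_(x <- s j) a x by have [] := projT2 (cid (step j)).
have s0 m : (0 < size (s m))%N.
  by have := sa m; case: (s m) => //; rewrite big_nil ler10.
have [x xS] := concat_sequence s0.
have sumS (f : E -> R) m N : map x (iota 0 N) = flatten (mkseq s m) ->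
    \sum_(i < N) f (x i) = \sum_(j < m) \sum_(y <- s j) f y.
  move=> xN; rewrite -(big_mkord xpredT (fun i => f (x i))) /index_iota subn0.
  rewrite -(big_map x xpredT f) xN big_flatten/= big_map.
  by rewrite -(big_mkord xpredT (fun j => \sum_(y <- s j) f y)) /index_iota subn0.
have geo m : \sum_(j < m) (2 ^+ j)^-1 <= 2 - (2 ^+ m)^-1 * 2 :> R.
  elim: m => [|m ih]; first by rewrite big_ord0 expr0 invr1 mul1r subrr.
  rewrite big_ord_recr/= exprS invfM mulrAC mulVf// mul1r.
  by have := ih; lra.
have wx : weakly_summable p x.
  move=> f [lf cf]; pose c := opnorm f + 1.
  have c0 : 0 < c by rewrite ltr_wpDl// opnorm_ge0.
  have fc z : rnorm (f z) <= c * rnorm z.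
    rewrite (le_trans (rnorm_le_opnorm z lf cf))// ler_wpM2r ?rnorm_ge0//.
    by rewrite lerDl.
  have cf1 : dual_ball_set (fun z => of_real c^-1 * f z).
    apply/dual_ball_setP; split.
      by move=> b u v; rewrite lf mulrDr mulrCA.
    move=> z; rewrite rnormM rnorm_of_real ger0_norm ?invr_ge0 ?(ltW c0)//.
    by rewrite ler_pdivrMl.
  pose phi := to_dual_ball cf1.
  have fphi z : rnorm (f z) `^ p = c `^ p * g z phi.
    rewrite /g eval_at_to_dual_ball rnormM rnorm_of_real ger0_norm ?invr_ge0 ?(ltW c0)//.
    by rewrite -powRM ?(ltW c0) ?mulr_ge0 ?invr_ge0 ?rnorm_ge0 ?(ltW c0)// mulVKf// gt_eqF.
  apply: (@nneseries_bounded _ (c `^ p * 2)) => [i|m]; first exact: powR_ge0.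
  under eq_bigr do rewrite fphi.
  rewrite -mulr_sumr ler_wpM2l ?powR_ge0//.
  have [N mN /(sumS (g ^~ phi)) xN] := xS m.
  apply: (@le_trans _ _ (\sum_(i < N) g (x i) phi)).
    rewrite -(subnK mN) addnC big_split_ord/= lerDl.
    by apply: sumr_ge0 => i _; exact: powR_ge0.
  rewrite xN; apply: (@le_trans _ _ (\sum_(j < m) (2 ^+ j)^-1)).
    by apply: ler_sum => j _; exact: sg.
  by rewrite (le_trans (geo m))// lerBlDr lerDl mulr_ge0// invr_ge0 exprn_ge0.
have := domP x wx; rewrite /absolutely_summable; set T := (X in (X < _)%E) => Tfin.
have T0 : (0 <= T)%E by apply: nneseries_ge0 => i _ _; rewrite lee_fin powR_ge0.
have Tf : T \is a fin_num by rewrite ge0_fin_numE.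
have [m Tm] : exists m : nat, fine T < m%:R.
  by exists (Num.bound (fine T)); rewrite archi_boundP// fine_ge0.
have [N mN /(sumS a) xN] := xS m.
have : \sum_(i < N) a (x i) <= fine T.
  rewrite -lee_fin fineK// -sumEFin -(big_mkord xpredT (fun i => (a (x i))%:E)).
  by apply: nneseries_lim_ge => i _ _; rewrite lee_fin powR_ge0.
rewrite xN leNgt (lt_le_trans Tm)//.
have -> : m%:R = \sum_(j < m) (1 : R) by rewrite sumr_const card_ord.
by apply: ler_sum => j _; exact: sa.
Qed.

Lemma dominated_norm_ge0 : 0 <= dominated_norm n p P.
Proof.
have [[C SC]|S0] := pselect (exists C, 0 < C /\ exists mu : probability B R,
    regular_measure mu /\ domination n p P mu C).
  by apply: lb_le_inf; [exists C | move=> y [/ltW]].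
rewrite /dominated_norm (_ : [set _ | _] = set0) ?inf0//.
by rewrite -subset0 => C SC; apply: S0; exists C.
Qed.

Lemma dominated_norm_le mu C : regular_measure mu -> 0 <= C ->
  domination n p P mu C -> dominated_norm n p P <= C.
Proof.
move=> rmu C0 dom; apply/ler_addgt0Pr => e e0; apply: ge_inf.
  by exists 0 => y [/ltW].
split; first by rewrite ltr_wpDl.
exists mu; split => //; apply/dominationP => x; have /dominationP/(_ x) := dom.
by move=> /le_trans; apply; rewrite ler_wpM2r ?powR_ge0// lerDl ltW.
Qed.

(** For a fixed finite family and a fixed bound the inequality passes to the
    infimum over the constants [C], although each [C] comes with its own measure.
    Together with [pietsch_dominated] this shows that the dominated norm is
    attained by one measure. *)
Lemma family_domination_norm : rhomogeneous n P -> dominated n p P ->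
  family_domination n p P (dominated_norm n p P `^ (p / n%:R)).
Proof.
move=> hP /(dominated_family hP)[D D0 /(pietsch_dominated hP D0)[mu0 [rmu0 dom0]]].
set d := dominated_norm n p P.
have d0 : 0 <= d := dominated_norm_ge0.
move=> s M sM.
have M0 : 0 <= M by apply: le_trans (sM point); apply: sumr_ge0 => x _; exact: powR_ge0.
set A := \sum_(x <- s) _.
have A0 : 0 <= A by apply: sumr_ge0 => x _; exact: powR_ge0.
have np0 : 0 <= n%:R / p by rewrite divr_ge0// ltW.
have pn0 : 0 <= p / n%:R by rewrite divr_ge0// ltW.
have AC C mu : 0 < C -> domination n p P mu C -> A `^ (n%:R / p) <= C * M `^ (n%:R / p).
  move=> C0 /(domination_family (ltW C0))/(_ s M sM) AM.
  rewrite -[C](pn_K (ltW C0)) -powRM ?powR_ge0//.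
  by apply: ge0_ler_powR => //; rewrite nnegrE ?mulr_ge0 ?powR_ge0.
suff : A `^ (n%:R / p) <= d * M `^ (n%:R / p).
  move=> h; rewrite -[leLHS](np_K A0) -[M](np_K M0) -powRM ?powR_ge0//.
  by apply: ge0_ler_powR => //; rewrite nnegrE ?mulr_ge0 ?powR_ge0.
pose C0 := D `^ (n%:R / p) + 1.
have C00 : 0 < C0 by rewrite ltr_wpDl// powR_ge0.
have dom00 : domination n p P mu0 C0.
  apply/dominationP => x; have /dominationP/(_ x) := dom0.
  by move=> /le_trans; apply; rewrite ler_wpM2r ?powR_ge0// lerDl.
have [Mn0|Mn0] := eqVneq (M `^ (n%:R / p)) 0.
  by have := AC _ _ C00 dom00; rewrite Mn0 !mulr0.
have {}Mn0 : 0 < M `^ (n%:R / p) by rewrite lt_neqAle eq_sym Mn0 powR_ge0.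
rewrite -ler_pdivrMr//; apply: lb_le_inf; first by exists C0; split => //; exists mu0.
by move=> C [Cgt0 [mu [_ domC]]]; rewrite ler_pdivrMr//; exact: AC domC.
Qed.

End FamilyDomination.

(** * Extension of a polynomial from a dense subspace *)
Section PolynomialExtension.
Context {R : realType} {k : scalar_field}.
Local Notation K := (scalars R k).

Lemma rnorm_sum (V : normedModType K) (I : Type) (r : seq I) (f : I -> V) :
  rnorm (\sum_(i <- r) f i) <= \sum_(i <- r) rnorm (f i).
Proof.
elim/big_rec2 : _ => [|i x y _ ih]; first by rewrite rnorm0.
by rewrite (le_trans (rnormD _ _))// lerD2l.
Qed.

Lemma rcauchy_cvg (V : completeNormedModType K) (u : nat -> V) :
  (forall e : R, 0 < e -> exists N, forall i j, (N <= i)%N -> (N <= j)%N ->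
     rnorm (u i - u j) < e) -> cvgn u.
Proof.
move=> cu; apply/cauchy_cvgP/cauchy_exP => e e0.
have [|N uN] := cu (sRe e).
  by rewrite -(@of_real_lt R k) of_real0 of_real_sRe// ltW.
exists (u N); exists N => // j /= Nj.
by rewrite -ball_normE/= -rnormE -(of_real_sRe (ltW e0)) of_real_lt uN.
Qed.

Lemma cvg_seq_unique (V : normedModType K) (u : nat -> V) (l l' : V) :
  u @ \oo --> l -> u @ \oo --> l' -> l = l'.
Proof. by apply: cvg_unique; exact: norm_hausdorff. Qed.

Lemma cvg_seq_sum (V : normedModType K) (I : Type) (r : seq I) (u : I -> nat -> V) l :
  (forall i, u i @ \oo --> l i) ->
  (\sum_(i <- r) u i j) @[j --> \oo] --> \sum_(i <- r) l i.
Proof.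
move=> ul; elim: r => [|i r ih].
  by rewrite big_nil; under eq_fun do rewrite big_nil; exact: cvg_cst.
rewrite big_cons; under eq_fun do rewrite big_cons.
exact: (cvgD (ul i) ih).
Qed.

Context (n : nat) (X G : normedModType K) (F : completeNormedModType K).
Variables (T : {linear X -> G}) (A : ('I_n -> X) -> F) (P : X -> F) (C : R).
Hypothesis mA : multilinear A.
Hypothesis PA : P = fun x => A (fun=> x).
Hypothesis C0 : 0 <= C.
Hypothesis PC : forall x, rnorm (P x) <= C * rnorm (T x) ^+ n.
Hypothesis Tdense : forall g (e : R), 0 < e -> exists x, rnorm (g - T x) < e.

Let M : ('I_n -> X) -> F := polar P.

Let mM : multilinear M. Proof. by rewrite /M PA; exact: multilinear_polar. Qed.

Let MP x : M (fun=> x) = polar_count (K := K) (n := n) *: P x.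
Proof. by rewrite /M PA polar_diag. Qed.

(** Each of the [2 ^ n] terms of [polar P] is the value of [P] at a sum of at most
    [n] vectors. *)
Let Mbound x r : (forall i, rnorm (T (x i)) <= r) ->
  rnorm (M x) <= #|{ffun 'I_n -> bool}|%:R * (C * (n%:R * r) ^+ n).
Proof.
move=> xr; rewrite /M /polar (le_trans (rnorm_sum _ _))//.
rewrite mulr_natl.
have -> : (C * (n%:R * r) ^+ n) *+ #|{ffun 'I_n -> bool}| =
    \sum_(s : {ffun 'I_n -> bool}) (C * (n%:R * r) ^+ n) by rewrite sumr_const.
apply: ler_sum => s _; rewrite rnormZ.
have -> : rnorm (\prod_i (if s i then 1 else -1) : K) = 1.
  elim/big_ind : _ => [|a b a1 b1|i _]; first exact: rnorm1.
    by rewrite rnormM a1 b1 mulr1.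
  by case: (s i); rewrite ?rnormN rnorm1.
rewrite mul1r (le_trans (PC _))// ler_wpM2l// lerXn2r ?nnegrE ?rnorm_ge0//.
  by case: n x xr => [|m] x xr; rewrite ?mul0r// mulr_ge0// (le_trans _ (xr ord0))// rnorm_ge0.
rewrite linear_sum (le_trans (rnorm_sum _ _))//.
have -> : n%:R * r = \sum_(i < n) r by rewrite sumr_const card_ord mulr_natl.
apply: ler_sum => i _; rewrite linearZ rnormZ.
by case: (s i); rewrite ?rnorm1 ?mul1r// rnorm0 mul0r (le_trans _ (xr i))// rnorm_ge0.
Qed.

(** Replace the arguments [x] of [M] by [y] one at a time; each step is the value of
    [M] with one argument [x - y], out of which the factor [s] is taken.  A positive
    [s] above the seminorm of [x - y], rather than the seminorm itself, avoids
    dividing by 0. *)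
Let P_lipschitz (r : R) : exists2 L, 0 <= L & forall x y s,
  rnorm (T x) <= r -> rnorm (T y) <= r -> 0 < s -> rnorm (T (x - y)) <= s ->
  rnorm (P x - P y) <= L * s.
Proof.
have [r0|r0] := ltP r 0.
  exists 0 => // x y s xr; have := rnorm_ge0 (T x).
  by rewrite leNgt (le_lt_trans xr r0).
pose K0 := #|{ffun 'I_n -> bool}|%:R * (C * (n%:R * (r + 1)) ^+ n).
pose N : K := polar_count (K := K) (n := n).
have N0 : N != 0 by exact: polar_count_neq0.
exists (rnorm N^-1 * (n%:R * K0)).
  by rewrite !mulr_ge0 ?rnorm_ge0 ?exprn_ge0 ?mulr_ge0 ?addr_ge0.
move=> x y s xr yr s0 xys.
have -> : P x - P y = N^-1 *: (M (fun=> x) - M (fun=> y)).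
  by rewrite !MP -scalerBr scalerA mulVf// scale1r.
rewrite rnormZ -(mulrA (rnorm N^-1) (n%:R * K0) s) -(mulrA n%:R K0 s) ler_wpM2l ?rnorm_ge0//.
(* The first j arguments are y, the others x. *)
pose z (j : nat) (i : 'I_n) := if (i < j)%N then y else x.
have -> : M (fun=> x) - M (fun=> y) = \sum_(j < n) (M (z j) - M (z j.+1)).
  rewrite -(big_mkord xpredT (fun j => M (z j) - M (z j.+1))).
  rewrite (@telescope_sumr_eq _ _ _ (fun j => - M (z j))) => [|//|j _]; last first.
    by rewrite opprK addrC.
  rewrite opprK [RHS]addrC; congr (_ - _); congr M; apply/funext => i; rewrite /z ?ltn0//.
  by rewrite ltn_ord.
have -> : n%:R * (K0 * s) = \sum_(j < n) (K0 * s).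
  by rewrite sumr_const card_ord mulr_natl.
rewrite (le_trans (rnorm_sum _ _))//; apply: ler_sum => j _.
have zE w : dfwith (z j) j w = fun i => if i == j then w else z j i.
  apply/funext => i; case: dfwithP => [|i' ii']; first by rewrite eqxx.
  by rewrite eq_sym (negPf ii').
pose w := of_real s^-1 *: (x - y) : X.
have sw : of_real s *: w = x - y.
  by rewrite scalerA -of_realM divff ?gt_eqF// of_real1 scale1r.
have -> : M (z j) - M (z j.+1) = of_real s *: M (dfwith (z j) j w).
  have h := mM j (z j) (of_real s) w y; rewrite sw subrK in h.
  rewrite -[RHS](addrK (M (dfwith (z j) j y))) -h !zE.
  congr (_ - _); congr M; apply/funext => i; rewrite /z; case: eqP => [->|ij].
  - by rewrite ltnn.
  - by [].
  - by rewrite ltnSn.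
  - have ij' : (i : nat) != j by apply/eqP => /val_inj.
    by rewrite ltnS leq_eqVlt (negPf ij').
rewrite rnormZ rnorm_of_real (gtr0_norm s0) mulrC ler_wpM2r ?(ltW s0)//.
apply: Mbound => i; rewrite zE; case: eqP => _.
  rewrite /w linearZ rnormZ rnorm_of_real ger0_norm ?invr_ge0 ?(ltW s0)//.
  by rewrite ler_pdivrMl// (le_trans xys)// mulrC ler_peMl ?(ltW s0)// lerDr.
by rewrite /z; case: ifP => _; rewrite ?(le_trans xr) ?(le_trans yr)// lerDl.
Qed.

Let P_near g (e : R) : 0 < e -> exists2 d, 0 < d & forall x y,
  rnorm (g - T x) < d -> rnorm (g - T y) < d -> rnorm (P x - P y) < e.
Proof.
move=> e0; have [L L0 hL] := P_lipschitz (rnorm g + 1).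
pose s := e / (L + 1).
have s0 : 0 < s by rewrite divr_gt0// ltr_wpDl.
exists (Num.min 1 (s / 2)); first by rewrite lt_min ltr01 divr_gt0.
move=> x y; rewrite !lt_min => /andP[x1 xs] /andP[y1 ys].
have near_bound z : rnorm (g - T z) < 1 -> rnorm (T z) <= rnorm g + 1.
  move=> z1; rewrite -[T z](subKr g) (le_trans (rnormD _ _))// rnormN lerD2l.
  exact: ltW.
apply: (@le_lt_trans _ _ (L * s)).
  apply: hL => //; [exact: near_bound | exact: near_bound |].
  have -> : T (x - y) = (g - T y) - (g - T x).
    by rewrite linearB opprB [RHS]addrC addrA subrK.
  rewrite (le_trans (rnormD _ _))// rnormN [leRHS]splitr.
  by rewrite lerD// ltW.
by rewrite /s mulrA ltr_pdivrMr ?ltr_wpDl// mulrC ltr_pM2l// ltrDl.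
Qed.

Let approx g (j : nat) : {x | rnorm (g - T x) < j.+1%:R^-1}.
Proof. by apply: cid; apply: Tdense; rewrite invr_gt0. Qed.

Let approx_near g d : 0 < d -> \forall j \near \oo, rnorm (g - T (sval (approx g j))) < d.
Proof.
move=> d0; have [N Nd] : exists N : nat, N.+1%:R^-1 < d.
  exists (Num.bound d^-1); rewrite invf_plt ?posrE//.
  have : d^-1 < (Num.bound d^-1)%:R by rewrite archi_boundP// invr_ge0 ltW.
  by move=> /lt_trans; apply; rewrite ltr_nat.
exists N => // j /= Nj; apply: lt_trans (svalP (approx g j)) _.
by apply: le_lt_trans Nd; rewrite lef_pV2 ?posrE// ler_nat.
Qed.

Definition extension (g : G) : F := limn (fun j => P (sval (approx g j))).

Let Q := extension.

Let Q_near g (e : R) : 0 < e -> exists2 d, 0 < d & forall x,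
  rnorm (g - T x) < d -> rnorm (Q g - P x) < e.
Proof.
move=> e0; have e2 : 0 < e / 2 by rewrite divr_gt0.
have [d d0 hd] := P_near g e2; exists d => // x xd.
have /rcvgP/(_ _ e2) Qc : (fun j => P (sval (approx g j))) @ \oo --> Q g.
  apply: rcauchy_cvg => e' e'0; have [d' d'0 hd'] := P_near g e'0.
  have [N _ hN] := approx_near g d'0; exists N => i j Ni Nj.
  by apply: hd'; apply: hN.
have [N _ /(_ _ (leqnn N)) [h1 h2]] := filterI Qc (approx_near g d0).
rewrite -[Q g](subrK (P (sval (approx g N)))) -addrA [ltRHS]splitr.
by rewrite (le_lt_trans (rnormD _ _))// ltrD// hd.
Qed.

Let Q_cvg (x : nat -> X) g : T (x j) @[j --> \oo] --> g -> P (x j) @[j --> \oo] --> Q g.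
Proof.
move=> /rcvgP xg; apply/rcvgP => e e0; have [d d0 hd] := Q_near g e0.
by apply: filterS (xg d d0) => j; exact: hd.
Qed.

Lemma extensionE x : extension (T x) = P x.
Proof.
apply/esym; apply: (@cvg_seq_unique _ (fun _ : nat => P x)).
  exact: cvg_cst.
by apply: (@Q_cvg (fun=> x)); exact: cvg_cst.
Qed.

Lemma extension_le g : rnorm (extension g) <= C * rnorm g ^+ n.
Proof.
pose x j := sval (approx g j).
have xg : T (x j) @[j --> \oo] --> g by apply/rcvgP => e; exact: approx_near.
have nc (V : normedModType K) (u : nat -> V) l : u @ \oo --> l ->
    rnorm (u j) @[j --> \oo] --> rnorm l.
  by move=> ul; apply: (@cvg_comp _ _ _ u (fun y => rnorm y) _ _ _ ul); exact: rnorm_continuous.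
apply: (ler_cvg_to (nc _ _ _ (Q_cvg xg))); last by apply: nearW => j; exact: PC.
have xn : rnorm (T (x j)) ^+ n @[j --> \oo] --> rnorm g ^+ n.
  exact: (cvg_comp _ _ (nc _ _ _ xg) (@exprn_continuous R n (rnorm g))).
exact: cvgMr xn.
Qed.

Let polar_cvg (x : nat -> 'I_n -> X) (g : 'I_n -> G) :
  (forall i, T (x j i) @[j --> \oo] --> g i) ->
  polar P (x j) @[j --> \oo] --> polar Q g.
Proof.
move=> xg; apply: cvg_seq_sum => s.
apply: cvgZr; apply: Q_cvg.
under eq_fun do rewrite linear_sum.
apply: cvg_seq_sum => i.
by under eq_fun do rewrite linearZ; exact: cvgZr.
Qed.

(** The polar form of the extension is a limit of values of the multilinear map
    [polar P] at approximants.  These may be chosen compatible with a given linear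
    combination, because the limit does not depend on them. *)
Lemma extension_polynomial : exists B : ('I_n -> G) -> F,
  multilinear B /\ forall g, extension g = B (fun=> g).
Proof.
pose N : K := polar_count (K := K) (n := n).
have N0 : N != 0 by exact: polar_count_neq0.
pose x g j := sval (approx g j).
have xg g : T (x g j) @[j --> \oo] --> g by apply/rcvgP => e; exact: approx_near.
have QN g : polar (n := n) Q (fun=> g) = N *: Q g.
  apply: (@cvg_seq_unique _ (fun j => M (fun=> x g j))).
    by apply: (@polar_cvg (fun j => fun=> x g j)) => i; exact: xg.
  by under eq_fun do rewrite MP; apply: cvgZr; exact: Q_cvg.
exists (fun g => N^-1 *: polar Q g); split=> [i g a u v|g]; last first.
  by rewrite QN scalerA mulVf// scale1r.
rewrite scalerA mulrC -scalerA -scalerDr; congr (_ *: _).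
have wcvg (y : nat -> X) w : T (y j) @[j --> \oo] --> w ->
    M (dfwith (fun i => x (g i) j) i (y j)) @[j --> \oo] --> polar Q (dfwith g i w).
  move=> yw; apply: (@polar_cvg (fun j => dfwith (fun i => x (g i) j) i (y j))) => l.
  have [<-|il] := eqVneq i l.
    by rewrite dfwithin; under eq_fun do rewrite dfwithin.
  by rewrite dfwithout//; under eq_fun do rewrite dfwithout//; exact: xg.
apply: (@cvg_seq_unique _
  (fun j => M (dfwith (fun i => x (g i) j) i (a *: x u j + x v j)))).
  apply: (@wcvg (fun j => a *: x u j + x v j)).
  under eq_fun do rewrite linearP.
  exact: (cvgD (cvgZr (xg u)) (xg v)).
under eq_fun do rewrite mM.
exact: (cvgD (cvgZr (wcvg _ _ (xg u))) (wcvg _ _ (xg v))).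
Qed.

End PolynomialExtension.

(** * Linearization on the projective symmetric tensor product *)
Section CompletionExtension.
Context {R : realType} {k : scalar_field} {V : lmodType (scalars R k)}.
Local Notation K := (scalars R k).
Variables (q : seminorm V) (F : completeNormedModType K) (f : {linear V -> F}) (C : R).
Hypothesis fC : forall x, rnorm (f x) <= C * q x.

Let W (u : cauchy_space q) : F := limn (fun j => f (val u j)).

Let Wcvg u : f (val u j) @[j --> \oo] --> W u.
Proof.
apply: rcauchy_cvg => e e0.
have C0 : 0 < `|C| + 1 by rewrite ltr_wpDl.
have [|N uN] := asboolP _ (valP u) (e / (`|C| + 1)); first by rewrite divr_gt0.
exists N => i j Ni Nj; rewrite -linearB (le_lt_trans (fC _))//.
apply: (@le_lt_trans _ _ ((`|C| + 1) * q (val u i - val u j))).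
  by rewrite ler_wpM2r ?seminorm_ge0// (le_trans (ler_norm _))// lerDl.
by rewrite mulrC -ltr_pdivlMr// uN.
Qed.

Let Wlin a u v : W (a *: u + v) = a *: W u + W v.
Proof.
apply: (@cvg_seq_unique R k F (fun j => f (val (a *: u + v) j)) _ _ (@Wcvg _)).
have e j : f (val (a *: u + v) j) = a *: f (val u j) + f (val v j).
  by rewrite -linearP.
under eq_fun do rewrite e.
exact: (cvgD (cvgZr (@Wcvg u)) (@Wcvg v)).
Qed.

Let Wle u : rnorm (W u) <= C * Defs.lim_norm u.
Proof.
have h : rnorm (f (val u j)) @[j --> \oo] --> rnorm (W u).
  exact: (cvg_comp _ _ (@Wcvg u) (@rnorm_continuous _ _ F (W u))).
have h' : C * q (val u j) @[j --> \oo] --> C * Defs.lim_norm u.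
  exact: cvgMr (@lim_norm_cvg R k V q u).
apply: (ler_cvg_to h h').
by apply: nearW => j; exact: fC.
Qed.

(** The limit of [f] along a Cauchy sequence is bounded by [C] times the limit
    seminorm, so it only depends on the class of the sequence. *)
Lemma completion_extension : exists v : {linear completion q -> F},
  [/\ continuous v, forall x, v (to_completion q x) = f x &
      forall u, rnorm (v u) <= C * rnorm u].
Proof.
pose v (u : completion q) : F := W (seprepr u).
have vpi c : v (seppi (lim_seminorm q) c) = W c.
  have /seppi_eq h := sepreprK (seppi (lim_seminorm q) c).
  apply/eqP; rewrite -subr_eq0; apply/eqP/rnorm_eq0/eqP.
  rewrite eq_le rnorm_ge0 andbT /v.
  have := Wle (seprepr (seppi (lim_seminorm q) c) - c).
  have -> : Defs.lim_norm (seprepr (seppi (lim_seminorm q) c) - c) = 0 by exact: h.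
  rewrite mulr0; congr (rnorm _ <= _).
  have := Wlin (-1) c (seprepr (seppi (lim_seminorm q) c)).
  by rewrite !scaleN1r addrC => ->; rewrite addrC.
have vlin : linear v.
  move=> a u w; rewrite -[u]sepreprK -[w]sepreprK -linearP !vpi.
  exact: Wlin.
have vle u : rnorm (v u) <= C * rnorm u.
  rewrite -[u]sepreprK vpi; apply: le_trans (Wle _) _.
  by rewrite rnorm_seppi.
pose v' : {linear completion q -> F} := HB.pack v (GRing.isLinear.Build _ _ _ _ v vlin).
exists v'; split => //.
- exact: bounded_linear_continuous vlin vle.
- move=> x; rewrite -[LHS]/(v _) /to_completion vpi.
  by apply: (@cvg_seq_unique R k F (fun=> f x) _ _ (@Wcvg (cst_cauchy q x))); exact: cvg_cst.
Qed.

End CompletionExtension.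

Section Linearization.
Context {R : realType} {k : scalar_field} (n : nat).
Local Notation K := (scalars R k).
Variables (G : normedModType K) (F : completeNormedModType K).
Variables (Q : G -> F) (A : ('I_n -> G) -> F) (C : R).
Hypothesis mA : multilinear A.
Hypothesis QA : forall g, Q g = A (fun=> g).
Hypothesis C0 : 0 <= C.
Hypothesis QC : forall g, rnorm (Q g) <= C * rnorm g ^+ n.

Let functional := {l : F -> K | forall a u v, l (a *: u + v) = a * l u + l v}.

(** Scalar forms separate the symmetric tensors by definition; composing [A] with
    linear functionals of [F] transfers this to values in [F]. *)
Let form (l : functional) : mform n G.
Proof.
exists (fun g => sval l (A g)) => i x a u v.
by rewrite mA; exact: (svalP l).
Defined.

Let l0 (l : functional) : sval l 0 = 0.
Proof.
by have := svalP l (-1) 0 0; rewrite scaler0 addr0 mulN1r addNr.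
Qed.

Let separation (y y' : F) : (forall l : functional, sval l y = sval l y') -> y = y'.
Proof.
move=> h; apply/eqP; rewrite -subr_eq0; apply/negPn/negP => yy.
have [l [ll l1]] := linear_functional_separates yy.
have := h (exist _ l ll) => /= ly.
have := ll (-1) y' y; rewrite scaleN1r addrC l1 ly mulN1r addNr.
by move/eqP; rewrite oner_eq0.
Qed.

(** The value at [th] is [\sum_i c i *: Q (x i)] for any representation of [th];
    characterizing it by linear functionals makes independence of the
    representation automatic. *)
Let lin_ex (th : sym_tensor n G) : exists y, forall l, sval l y = val th (form l).
Proof.
have /asboolP[m [c [x ->]]] := valP th.
exists (\sum_(i < m) c i *: Q (x i)) => l.
have ls (I : Type) (r : seq I) (u : I -> F) (b : I -> K) :
    sval l (\sum_(i <- r) b i *: u i) = \sum_(i <- r) b i * sval l (u i).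
  elim: r => [|i r ih]; first by rewrite !big_nil l0.
  by rewrite !big_cons (svalP l) ih.
rewrite ls fct_sumE; apply: eq_bigr => i _.
by rewrite QA.
Qed.

Let v0 th : F := sval (cid (lin_ex th)).

Let v0E th l : sval l (v0 th) = val th (form l).
Proof. exact: (svalP (cid (lin_ex th))). Qed.

Let v0_linear : linear v0.
Proof.
move=> a th th'; apply: separation => l.
by rewrite (svalP l) !v0E.
Qed.

Let v0_pow g : v0 (sym_pow n g) = Q g.
Proof. by apply: separation => l; rewrite v0E QA. Qed.

Let v0_le th : rnorm (v0 th) <= C * pi_s th.
Proof.
pose V0 : {linear sym_tensor n G -> F} := HB.pack v0 (GRing.isLinear.Build _ _ _ _ v0 v0_linear).
have h r : pi_s_set th r -> rnorm (v0 th) <= C * r.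
  move=> [m [c [x [-> ->]]]]; rewrite -[v0]/(V0 : _ -> _) linear_sum.
  rewrite (le_trans (rnorm_sum _ _))// mulr_sumr; apply: ler_sum => i _.
  rewrite linearZ /= v0_pow rnormZ mulrCA ler_wpM2l ?rnorm_ge0//.
have [C00|Cn0] := eqVneq C 0.
  by have [r /h] := pi_s_set_neq0 th; rewrite C00 !mul0r.
have {}Cn0 : 0 < C by rewrite lt_neqAle eq_sym Cn0.
rewrite mulrC -ler_pdivrMr//; apply: lb_le_inf; first exact: pi_s_set_neq0.
by move=> r /h; rewrite ler_pdivrMr// mulrC.
Qed.

Lemma polynomial_linearization : exists v : {linear proj_sym_tensor n G -> F},
  [/\ continuous v, forall g, v (delta n G g) = Q g & opnorm v <= C].
Proof.
pose V0 : {linear sym_tensor n G -> F} := HB.pack v0 (GRing.isLinear.Build _ _ _ _ v0 v0_linear).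
have [v [cv vV0 vC]] := @completion_extension R k _ (@pi_seminorm R k n G) F V0 C v0_le.
exists v; split => //.
  by move=> g; rewrite /delta vV0; exact: v0_pow.
apply: opnorm_le => u u1; apply: le_trans (vC u) _.
by rewrite ler_piMr.
Qed.

End Linearization.

Lemma rnorm_delta_le (R : realType) (k : scalar_field) (n : nat)
  (G : normedModType (scalars R k)) (g : G) : rnorm (delta n G g) <= rnorm g ^+ n.
Proof.
rewrite rnorm_to_completion; apply: pi_s_lb.
exists 1%N, (fun=> 1), (fun=> g); rewrite !big_ord1 scale1r rnorm1 mul1r.
by [].
Qed.

(** * Factorization through the Pietsch space *)
Section Homogeneity.
Context {R : realType} {k : scalar_field} {E F : normedModType (scalars R k)}.

Lemma rnormX (a : scalars R k) n : rnorm (a ^+ n) = rnorm a ^+ n.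
Proof. by elim: n => [|n ih]; rewrite ?expr0 ?rnorm1// !exprS rnormM ih. Qed.

Lemma homogeneous_polynomial_rhomogeneous n (P : E -> F) :
  homogeneous_polynomial n P -> rhomogeneous n P.
Proof.
move=> [A [mA PA]] t x t0.
by rewrite !PA multilinear_scale// rnormZ rnormX rnorm_of_real ger0_norm.
Qed.

End Homogeneity.

Section Factorization.
Context {R : realType} {k : scalar_field} {E : normedModType (scalars R k)}.
Variables (mu : probability (dual_ball E) R) (p : R) (p1 : 1 <= p).
Let p0 : 0 < p. Proof. exact: lt_le_trans p1. Qed.

Definition to_GEp (x : E) : GEp mu p1 := j_e_to_G mu p1 (emb x).

Lemma to_GEp_linear : linear to_GEp.
Proof. by move=> a x y; apply: val_inj; exact: j_e_lin. Qed.

Lemma rnorm_to_GEp x : rnorm (to_GEp x) = eval_moment p mu x `^ p^-1.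
Proof.
rewrite rnorm_GEp rnorm_seppi /=; apply: EFin_inj; rewrite Lp_fun_normE /Lp_norm.
rewrite unlock /= -poweR_EFin -eval_momentE//; congr (_ `^ _)%E.
by apply: eq_integral => phi _; rewrite /= ger0_norm ?rnorm_ge0.
Qed.

Lemma rnorm_to_GEp_exp x n : rnorm (to_GEp x) ^+ n = eval_moment p mu x `^ (n%:R / p).
Proof. by rewrite rnorm_to_GEp -powR_mulrn ?powR_ge0// -powRrM mulrC. Qed.

Lemma to_GEp_dense (g : GEp mu p1) (e : R) : 0 < e -> exists x, rnorm (g - to_GEp x) < e.
Proof.
move=> e0; have /asboolP cg := valP g.
have eK : 0 < of_real e :> scalars R k by rewrite of_real_gt0.
have [_ [[x _ <-]]] := cg _ (nbhsx_ballx (val g) _ eK).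
by rewrite -ball_normE/= -rnormE of_real_lt => h; exists x.
Qed.

Variables (n : nat) (F : completeNormedModType (scalars R k)) (P : E -> F).

(** The norm in the tensor product of the power of [g] is at most [rnorm g ^+ n], and
    the [n]-th power of the norm of [to_GEp x] is the right-hand side of the
    domination inequality. *)
Lemma factorization_domination (v : {linear proj_sym_tensor n (GEp mu p1) -> F}) :
  continuous v -> P = v \o delta n (GEp mu p1) \o j_e_to_G mu p1 \o emb (E := E) ->
  domination n p P mu (opnorm v).
Proof.
move=> cv Pv; apply/dominationP => // x; rewrite -rnorm_to_GEp_exp.
have lv : linear v by move=> a u w; rewrite linearP.
rewrite [in leLHS]Pv /= (le_trans (rnorm_le_opnorm _ lv cv))//.
by rewrite ler_wpM2l ?opnorm_ge0// rnorm_delta_le.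
Qed.

(** Domination says that [P] is bounded by the [n]-th power of the seminorm
    [rnorm \o to_GEp].  Hence it extends from the dense image of [to_GEp] to a
    polynomial on the whole Pietsch space, and that polynomial linearizes. *)
Lemma domination_factorization C : homogeneous_polynomial n P -> 0 <= C ->
  domination n p P mu C ->
  exists v : {linear proj_sym_tensor n (GEp mu p1) -> F},
    [/\ continuous v,
        P = v \o delta n (GEp mu p1) \o j_e_to_G mu p1 \o emb (E := E) &
        opnorm v <= C].
Proof.
move=> [A [mA /funext PA]] C0 /(dominationP _ p0) PC.
pose T : {linear E -> GEp mu p1} := HB.pack to_GEp
  (GRing.isLinear.Build _ _ _ _ to_GEp to_GEp_linear).
have {}PC x : rnorm (P x) <= C * rnorm (T x) ^+ n by rewrite rnorm_to_GEp_exp.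
have [B [mB QB]] := extension_polynomial mA PA C0 PC to_GEp_dense.
have [v [cv vQ vC]] := polynomial_linearization mB QB C0
  (extension_le mA PA C0 PC to_GEp_dense).
exists v; split => //; apply/funext => x /=.
by rewrite vQ -(extensionE mA PA C0 PC to_GEp_dense).
Qed.

End Factorization.

Theorem proposition4p4 (R : realType) (k : scalar_field)
    (n : nat) (n_gt0 : (0 < n)%N) (p : R) (n_le_p : n%:R <= p)
    (E F : completeNormedModType (scalars R k)) (P : E -> F)
    (P_poly : homogeneous_polynomial n P) (P_cont : continuous P) :
  let p1 := exponent_ge1 n_gt0 n_le_p in
  (dominated n p P <->
     exists mu : probability (dual_ball E) R, regular_measure mu /\
     exists v : {linear proj_sym_tensor n (GEp mu p1) -> F},
       continuous v /\
       P = v \o delta n (GEp mu p1) \o j_e_to_G mu p1 \o emb (E := E))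
  /\
  (dominated n p P ->
     exists mu : probability (dual_ball E) R, regular_measure mu /\
     exists v : {linear proj_sym_tensor n (GEp mu p1) -> F},
       [/\ continuous v,
           P = v \o delta n (GEp mu p1) \o j_e_to_G mu p1 \o emb (E := E) &
           opnorm v = dominated_norm n p P]).
Proof.
move=> p1; have p0 : 0 < p by exact: lt_le_trans p1.
have hP := homogeneous_polynomial_rhomogeneous P_poly.
have factor : dominated n p P ->
     exists mu : probability (dual_ball E) R, regular_measure mu /\
     exists v : {linear proj_sym_tensor n (GEp mu p1) -> F},
       [/\ continuous v,
           P = v \o delta n (GEp mu p1) \o j_e_to_G mu p1 \o emb (E := E) &
           opnorm v = dominated_norm n p P].
  move=> domP; have fam := family_domination_norm n_gt0 p0 hP domP.
  have [mu [rmu]] := pietsch_dominated n_gt0 p0 hP (powR_ge0 _ _) fam.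
  rewrite -powRrM mulrA divfK ?gt_eqF ?ltr0n// divff ?gt_eqF// powRr1 ?dominated_norm_ge0// => dom.
  exists mu; split => //.
  have [v [cv Pv vC]] := domination_factorization p1 P_poly (dominated_norm_ge0 _ _ _) dom.
  exists v; split => //; apply/eqP; rewrite eq_le vC/=.
  apply: dominated_norm_le rmu _ (factorization_domination cv Pv) => //.
  by apply: opnorm_ge0 => // a u w; rewrite linearP.
split => //; split => [/factor[mu [rmu [v [cv Pv _]]]]|[mu [rmu [v [cv Pv]]]]].
  by exists mu; split => //; exists v.
have ov : 0 <= opnorm v by apply: opnorm_ge0 => // a u w; rewrite linearP.
apply: (family_dominated p0 (powR_ge0 _ _)).
exact: (domination_family n_gt0 p0 ov (factorization_domination cv Pv)).
Qed.
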